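(* Let $G$ be a countable group and $N\trianglelefteq G$ a finite normal subgroup such that every outer action of $H=G/N$ has a class-bijective lift. Then: (1) the inclusion $N\hookrightarrow G$ has the class-bijective lifting property; (2) every outer action of $G$ has a class-bijective lift.
   Context: A countable Borel equivalence relation (CBER) on a standard Borel space $X$ is a Borel equivalence relation with countable classes. $\mathrm{Aut}_B(E)$ is the group of Borel bijections $T:X\to X$ with $x\mathrel E y\iff T(x)\mathrel E T(y)$; $\mathrm{Inn}_B(E)$ is the normal subgroup of those $T$ with $T(x)\mathrel E x$ for all $x$; $\mathrm{Out}_B(E)=\mathrm{Aut}_B(E)/\mathrm{Inn}_B(E)$ with quotient map $p_E$. An outer action of a countable group $K$ is a homomorphism $\varphi:K\to\mathrm{Out}_B(E)$ for some CBER $E$; a lift of it is a homomorphism $\psi:K\to\mathrm{Aut}_B(E)$ with $p_E\circ\psi=\varphi$; a homomorphism $\psi:K\to\mathrm{Aut}_B(E)$ is class-bijective if for all $k\in K$, $x\in X$, $\psi(k)(x)\mathrel E x$ implies $\psi(k)(x)=x$. ''Every outer action of $K$ has a class-bijective lift'' means this holds for every CBER $E$ and every homomorphism $K\to\mathrm{Out}_B(E)$. A homomorphism $\iota:L\to K$ of countable groups has the class-bijective lifting property if for every CBER $E$, every class-bijective homomorphism $\alpha:L\to\mathrm{Aut}_B(E)$ and every homomorphism $\beta:K\to\mathrm{Out}_B(E)$ with $p_E\circ\alpha=\beta\circ\iota$, there is a class-bijective homomorphism $\gamma:K\to\mathrm{Aut}_B(E)$ with $p_E\circ\gamma=\beta$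 and $\gamma\circ\iota=\alpha$. *)

(* Defs.v *)
From HB Require Import structures.
From mathcomp Require Import all_boot.
From mathcomp Require Import all_classical all_reals all_analysis.

Set Implicit Arguments.
Unset Strict Implicit.
Unset Printing Implicit Defensive.

Local Open Scope classical_set_scope.
Local Open Scope group_scope.

Notation "{ 'ghom' G '->' H }" := (UMagmaMorphism.type G H)
  (at level 0, G at level 98, H at level 99, format "{ 'ghom'  G  ->  H }").

Record normalSubgroup (G : groupType) := NormalSubgroup {
  normal_set :> set G;
  normal1 : normal_set 1;
  normalM : forall x y, normal_set x -> normal_set y -> normal_set (x * y);
  normalV : forall x, normal_set x -> normal_set x^-1;
  normalJ : forall x y, normal_set x -> normal_set (x ^ y)
}.

Section Subgroup.
Variables (G : groupType) (N : normalSubgroup G).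

Definition subgroup : Type := {x : G | x \in normal_set N}.

HB.instance Definition _ := SubChoice.on subgroup.

Let subgroup_closed : group_closed (fun x : G => x \in normal_set N).
Proof.
split=> [|x y /set_mem xN /set_mem yN]; apply/mem_set; first exact: normal1.
by apply: normalM => //; apply: normalV.
Qed.

HB.instance Definition _ :=
  SubChoice_isSubGroup.Build G (fun x : G => x \in normal_set N) subgroup
    subgroup_closed.

Definition subgroup_incl : {ghom subgroup -> G} := (val : subgroup -> G).

End Subgroup.

Section Quotient.
Variables (G : groupType) (N : normalSubgroup G).
Local Open Scope quotient_scope.

Definition coset_rel : rel G := fun x y => `[< normal_set N (x^-1 * y) >].

Let coset_rel_refl : reflexive coset_rel.
Proof. by move=> x; apply/asboolP; rewrite mulVg; exact: normal1. Qed.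

Let coset_rel_sym : symmetric coset_rel.
Proof.
by move=> x y; apply/asboolP/asboolP => /normalV; rewrite invgM invgK.
Qed.

Let coset_rel_trans : transitive coset_rel.
Proof.
move=> y x z /asboolP xy /asboolP yz; apply/asboolP.
by have := normalM xy yz; rewrite -mulgA mulVKg.
Qed.

Canonical coset_equiv := EquivRel coset_rel coset_rel_refl coset_rel_sym
  coset_rel_trans.

Definition quotient_group : Type := {eq_quot coset_equiv}.

HB.instance Definition _ := Choice.on quotient_group.
HB.instance Definition _ : EqQuotient G coset_equiv quotient_group :=
  EqQuotient.on quotient_group.

Definition quot_map (x : G) : quotient_group := \pi x.

Definition quot_mul (a b : quotient_group) : quotient_group :=
  quot_map (repr a * repr b).
Definition quot_inv (a : quotient_group) : quotient_group :=
  quot_map (repr a)^-1.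

Lemma quot_mapP x y : quot_map x = quot_map y <-> normal_set N (x^-1 * y).
Proof.
split=> [/eqmodP/asboolP //|xy].
by apply/(@eqquotP _ coset_equiv quotient_group)/asboolP.
Qed.

Lemma quot_map_surj a : exists x, a = quot_map x.
Proof. by exists (repr a); rewrite /quot_map reprK. Qed.

Let repr_mapN x : normal_set N ((repr (quot_map x))^-1 * x).
Proof. by apply/quot_mapP; rewrite /quot_map reprK. Qed.

Let quot_mulE x y : quot_mul (quot_map x) (quot_map y) = quot_map (x * y).
Proof.
apply/quot_mapP; have := repr_mapN x; have := repr_mapN y.
set x' := repr (quot_map x); set y' := repr (quot_map y) => hy hx.
have := normalM (normalJ y' hx) hy.
by rewrite /conjg invgM !mulgA mulgK.
Qed.

Let quot_invE x : quot_inv (quot_map x) = quot_map x^-1.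
Proof.
apply/quot_mapP; have := repr_mapN x; set x' := repr (quot_map x) => hx.
have := normalJ x'^-1 (normalV hx).
by rewrite /conjg invgM !invgK mulgK.
Qed.

Let quot_mulA : associative quot_mul.
Proof.
move=> a b c; have [x ->] := quot_map_surj a; have [y ->] := quot_map_surj b.
have [z ->] := quot_map_surj c.
by rewrite (quot_mulE y z) (quot_mulE x y) (quot_mulE x) quot_mulE mulgA.
Qed.

Let quot_mul1 : left_id (quot_map 1) quot_mul.
Proof.
by move=> a; have [x ->] := quot_map_surj a; rewrite (quot_mulE 1 x) mul1g.
Qed.

Let quot_mulr1 : right_id (quot_map 1) quot_mul.
Proof.
by move=> a; have [x ->] := quot_map_surj a; rewrite (quot_mulE x 1) mulg1.
Qed.

Let quot_mulV : left_inverse (quot_map 1) quot_inv quot_mul.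
Proof.
move=> a; have [x ->] := quot_map_surj a.
by rewrite quot_invE (quot_mulE x^-1 x) mulVg.
Qed.

Let quot_mulrV : right_inverse (quot_map 1) quot_inv quot_mul.
Proof.
move=> a; have [x ->] := quot_map_surj a.
by rewrite quot_invE (quot_mulE x x^-1) mulgV.
Qed.

HB.instance Definition _ := isGroup.Build quotient_group
  quot_mulA quot_mul1 quot_mulr1 quot_mulV quot_mulrV.

Let quot_map_morph : {morph quot_map : x y / x * y}.
Proof. by move=> x y; rewrite -quot_mulE. Qed.

HB.instance Definition _ :=
  isUMagmaMorphism.Build G quotient_group quot_map (erefl, quot_map_morph).

End Quotient.

(** Isomorphic, as a measurable space, to the Borel space of a Polish space,
    i.e. of a separable completely metrizable space: a Hausdorff pseudometric is
    a metric. All models [R] of the reals are isomorphic. Types in [measurableType]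
    are inhabited; the omitted empty space has trivial automorphism group. *)
Definition standard_borel d (X : measurableType d) : Prop :=
  exists (R : realType) (T : completePseudoMetricType R) (f : X -> T),
    [/\ hausdorff_space T,
        exists2 D : set T, countable D & dense D,
        bijective f &
        forall A : set X,
          measurable A <-> exists2 B, <<s open >> B & A = f @^-1` B].

Record cber d (X : measurableType d) := Cber {
  cber_rel :> X -> X -> Prop;
  cber_refl : forall x, cber_rel x x;
  cber_sym : forall x y, cber_rel x y -> cber_rel y x;
  cber_trans : forall x y z, cber_rel x y -> cber_rel y z -> cber_rel x z;
  cber_measurable : measurable [set xy : X * X | cber_rel xy.1 xy.2];
  cber_countable : forall x, countable [set y | cber_rel x y]
}.

Section Automorphisms.
Context d (X : measurableType d) (E : cber X).

(** Borel measurability of the inverse is automatic on standard Borel spaces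
    (Lusin-Souslin); it is a field so that composition and inversion make this
    a group without appealing to that theorem. *)
Record aut := Aut {
  aut_fun :> X -> X;
  aut_inv : X -> X;
  aut_funK : cancel aut_fun aut_inv;
  aut_invK : cancel aut_inv aut_fun;
  aut_measurable : measurable_fun [set: X] aut_fun;
  aut_inv_measurable : measurable_fun [set: X] aut_inv;
  aut_rel : forall x y, E x y <-> E (aut_fun x) (aut_fun y)
}.

Lemma aut_ext (S T : aut) : (forall x, S x = T x) -> S = T.
Proof.
case: S T => [f f' fK f'K mf mf' fE] [g g' gK g'K mg mg' gE] /= fg.
have {fg} fg : f = g by apply/funext.
have f'g' : f' = g' by apply/funext => x; rewrite -[in LHS](g'K x) -fg fK.
case: _ / fg in gK g'K mg gE *; case: _ / f'g' in gK g'K mg' *.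
by congr Aut; apply: Prop_irrelevance.
Qed.

HB.instance Definition _ := gen_eqMixin aut.
HB.instance Definition _ := gen_choiceMixin aut.

Definition aut_one : aut.
Proof.
by refine (@Aut id id _ _ _ _ _) => //; exact: measurable_id.
Defined.

Definition aut_mul (S T : aut) : aut.
Proof.
refine (@Aut (S \o T) (aut_inv T \o aut_inv S) _ _ _ _ _).
- exact: can_comp (aut_funK S) (aut_funK T).
- exact: can_comp (aut_invK T) (aut_invK S).
- exact: measurableT_comp (aut_measurable S) (aut_measurable T).
- exact: measurableT_comp (aut_inv_measurable T) (aut_inv_measurable S).
- by move=> x y; rewrite (aut_rel T) (aut_rel S).
Defined.

Definition aut_inverse (T : aut) : aut.
Proof.
refine (@Aut (aut_inv T) T _ _ _ _ _).
- exact: aut_invK.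
- exact: aut_funK.
- exact: aut_inv_measurable.
- exact: aut_measurable.
- by move=> x y; rewrite (aut_rel T (aut_inv T x)) !aut_invK.
Defined.

Let aut_mulA : associative aut_mul.
Proof. by move=> S T U; apply: aut_ext. Qed.

Let aut_mul1 : left_id aut_one aut_mul.
Proof. by move=> T; apply: aut_ext. Qed.

Let aut_mulr1 : right_id aut_one aut_mul.
Proof. by move=> T; apply: aut_ext. Qed.

Let aut_mulV : left_inverse aut_one aut_inverse aut_mul.
Proof. by move=> T; apply: aut_ext => x /=; rewrite aut_funK. Qed.

Let aut_mulrV : right_inverse aut_one aut_inverse aut_mul.
Proof. by move=> T; apply: aut_ext => x /=; rewrite aut_invK. Qed.

HB.instance Definition _ := isGroup.Build aut
  aut_mulA aut_mul1 aut_mulr1 aut_mulV aut_mulrV.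

Definition inn_set : set aut := [set T | forall x, E (T x) x].

Let inn1 : inn_set 1.
Proof. by move=> x; exact: cber_refl. Qed.

Let innM S T : inn_set S -> inn_set T -> inn_set (S * T).
Proof. by move=> iS iT x; exact: cber_trans (iS _) (iT _). Qed.

Let innV T : inn_set T -> inn_set T^-1.
Proof.
move=> iT x; apply: cber_sym.
by have := iT (aut_inv T x); rewrite aut_invK.
Qed.

Let innJ S T : inn_set S -> inn_set (S ^ T).
Proof. by move=> iS x; apply/(aut_rel T) => /=; rewrite aut_invK. Qed.

Definition inn : normalSubgroup aut := NormalSubgroup inn1 innM innV innJ.

Definition out : groupType := quotient_group inn.

Definition out_map : {ghom aut -> out} := @quot_map aut inn.

End Automorphisms.

Definition class_bijective (K : groupType) d (X : measurableType d)
    (E : cber X) (psi : {ghom K -> aut E}) : Prop :=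
  forall k x, E (psi k x) x -> psi k x = x.

Definition outer_actions_lift (K : groupType) : Prop :=
  forall d (X : measurableType d), standard_borel X ->
  forall (E : cber X) (phi : {ghom K -> out E}),
  exists psi : {ghom K -> aut E},
    class_bijective psi /\ out_map E \o psi =1 phi.

Definition class_bijective_lifting_property (L K : groupType)
    (iota : {ghom L -> K}) : Prop :=
  forall d (X : measurableType d), standard_borel X ->
  forall (E : cber X) (alpha : {ghom L -> aut E}) (beta : {ghom K -> out E}),
  class_bijective alpha ->
  out_map E \o alpha =1 beta \o iota ->
  exists gamma : {ghom K -> aut E},
    [/\ class_bijective gamma,
        out_map E \o gamma =1 beta &
        gamma \o iota =1 alpha].

(* Main.v *)
Require Import Defs.
From HB Require Import structures.
From mathcomp Require Import all_boot all_order all_algebra.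
From mathcomp Require Import ring.
From mathcomp Require Import all_classical all_reals all_analysis.

Set Implicit Arguments.
Unset Strict Implicit.
Unset Printing Implicit Defensive.

(** Outer actions of the finite group [N]. Choose representatives [T n] and let
    [F] be the finite extension of [E] that they generate. A class-bijective
    lift is the same thing as a Borel partition of the space into transversals
    for the [E]-classes of each [F]-class. A maximal disjoint family of such
    transversals leaves, in every [F]-class, some [E]-class entirely covered;
    moving there and back along the transversals compresses each [E]-class into
    its covered part, and a Hilbert hotel shift absorbs the rest.

    Extension to [G]. Let [Y] be a Borel transversal of the [N]-orbits and [F]
    the relation generated by [E] and [N]. Both [Y] and its image under a
    representative [T g] of [beta g] are, inside [F], an "[m]-th part" of the
    space, so a cancellation law (greedy matching, then absorption of the part
    left over) matches them, and [T g] induces an automorphism of [F] on [Y].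
    This is an outer action of [G/N] on [Y]; it lifts by hypothesis, where [Y]
    is replaced by the whole space with the equality relation off [Y] so that
    no standard Borel structure on [Y] is needed. The lift then determines
    [gamma g x] as the point of the [N]-orbit obtained that lies in the
    [E]-class of [T g x].

    [E] itself is never uniformized: every construction takes place inside the
    orbits of a countable group of automorphisms, so neither Feldman-Moore nor
    Lusin-Novikov is used. *)

(** * Calculus of Borel predicates, maps and relations *)

Section DefinableSets.
Local Open Scope classical_set_scope.
Context d (X : measurableType d).
Implicit Types (P Q : X -> Prop) (u v : X -> X).

Definition bset P := measurable [set x | P x].
Definition bfun u := measurable_fun [set: X] u.
(** Relations are tested along pairs of Borel maps rather than as subsets of the product. This form
    is stable under substitution and countable quantifiers, so the greedy recursions below can be
    shown Borel by induction on the stage. *)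
Definition brel (R : X -> X -> Prop) :=
  forall u v, bfun u -> bfun v -> bset (fun x => R (u x) (v x)).

Lemma bset_ext P Q : (forall x, P x <-> Q x) -> bset Q -> bset P.
Proof.
by rewrite /bset => PQ; rewrite (_ : [set x | P x] = [set x | Q x])//;
  apply/seteqP; split=> x /= /PQ.
Qed.

Lemma bset_and P Q : bset P -> bset Q -> bset (fun x => P x /\ Q x).
Proof. exact: measurableI. Qed.

Lemma bset_or P Q : bset P -> bset Q -> bset (fun x => P x \/ Q x).
Proof. exact: measurableU. Qed.

Lemma bset_not P : bset P -> bset (fun x => ~ P x).
Proof. exact: measurableC. Qed.

Lemma bset_imp P Q : bset P -> bset Q -> bset (fun x => P x -> Q x).
Proof.
move=> mP mQ; apply: (bset_ext (Q := fun x => ~ P x \/ Q x)) => [x|].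
  by rewrite implyE.
exact: bset_or (bset_not mP) mQ.
Qed.

Lemma bset_iff P Q : bset P -> bset Q -> bset (fun x => P x <-> Q x).
Proof. by move=> mP mQ; apply: bset_and; apply: bset_imp. Qed.

Lemma bset_const (p : Prop) : bset (fun=> p).
Proof.
have [p1|p0] := pselect p.
  by apply: (bset_ext (Q := fun=> True)) => //; exact: measurableT.
by apply: (bset_ext (Q := fun=> False)) => //; exact: measurable0.
Qed.

Lemma bset_ex (I : countType) (P : I -> X -> Prop) :
  (forall i, bset (P i)) -> bset (fun x => exists i, P i x).
Proof.
move=> mP; rewrite /bset.
rewrite (_ : [set x | _] = \bigcup_(i in [set: I]) [set x | P i x]).
  by apply: countable_bigcupT_measurable.
by apply/seteqP; split=> x /= [i]; exists i.
Qed.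

Lemma bset_all (I : countType) (P : I -> X -> Prop) :
  (forall i, bset (P i)) -> bset (fun x => forall i, P i x).
Proof.
move=> mP; apply: (bset_ext (Q := fun x => ~ exists i, ~ P i x)) => [x|].
  by rewrite -forallNE; split=> h i; [move=> nP; exact: nP|exact: contrapT (h i)].
by apply/bset_not/bset_ex => i; apply: bset_not.
Qed.

Lemma bfun_id : bfun id. Proof. exact: measurable_id. Qed.

Lemma bfun_comp u v : bfun u -> bfun v -> bfun (fun x => u (v x)).
Proof. by move=> mu mv; apply: (measurableT_comp mu mv). Qed.

Lemma bfun_iter n u : bfun u -> bfun (iter n u).
Proof.
move=> mu; elim: n => [|n IH]; first exact: bfun_id.
exact: (bfun_comp mu IH).
Qed.

(** Such a family makes equality Borel, and it allows finite sets of points to be told apart by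
    finitely many natural numbers. *)
Definition separating (V : nat -> set X) :=
  (forall k, bset (V k)) /\
  forall x y, x <> y -> exists k, V k x /\ ~ V k y.

End DefinableSets.

Section DefinableMaps.
Local Open Scope classical_set_scope.
Context d d' (X : measurableType d) (Z : measurableType d').
Implicit Types (u v : Z -> X).

Lemma bset_comp (P : X -> Prop) u :
  bset P -> measurable_fun [set: Z] u -> bset (fun z => P (u z)).
Proof. by move=> mP mu; rewrite /bset -[X in measurable X]setTI; apply: mu. Qed.

Lemma bset_rel (R : X -> X -> Prop) u v :
  measurable [set xy : X * X | R xy.1 xy.2] ->
  measurable_fun [set: Z] u -> measurable_fun [set: Z] v ->
  bset (fun z => R (u z) (v z)).
Proof.
move=> mR mu mv; rewrite /bset -[X in measurable X]setTI.
exact: (measurable_fun_pair mu mv measurableT mR).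
Qed.

Lemma bset_eq (V : nat -> set X) u v : separating V ->
  measurable_fun [set: Z] u -> measurable_fun [set: Z] v ->
  bset (fun z => u z = v z).
Proof.
move=> [mV sV] mu mv.
apply: (bset_ext (Q := fun z => forall k, V k (u z) <-> V k (v z))) => [z|].
  split=> [->//|h]; apply: contrapT => /sV[k [/h]]; by [].
by apply: bset_all => k; apply: bset_iff; apply: bset_comp (mV k) _.
Qed.

End DefinableMaps.

Lemma brel_eq d (X : measurableType d) (V : nat -> set X) :
  separating V -> brel (@eq X).
Proof. by move=> sepV u v mu mv; exact: (bset_eq sepV mu mv). Qed.

(* A map with a definable graph that is covered by countably many measurable
   maps is measurable; no separation theorem for analytic sets is needed. *)
Lemma measurable_graph_cover d (X : measurableType d) (I : countType)
    (h : I -> X -> X) (R : X -> X -> Prop) :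
  (forall i, bfun (h i)) -> (forall i, bset (fun x => R x (h i x))) ->
  (forall x, exists y, R x y) -> (forall x y, R x y -> exists i, y = h i x) ->
  (forall x y y', R x y -> R x y' -> y = y') ->
  exists2 s : X -> X, bfun s & forall x y, s x = y <-> R x y.
Proof.
move=> mh mR totR Rh funR; have /choice[s sP] := totR.
exists s => [|x y]; last by split=> [<-//|/(funR _ _ _ (sP x))].
move=> _ B mB; rewrite setTI.
apply: (bset_ext (Q := fun x => exists i, R x (h i x) /\ B (h i x))).
  move=> x; split=> [Bsx|[i [Ri Bi]]]; last first.
    by rewrite /preimage /= (funR _ _ _ (sP x) Ri).
  by have [i si] := Rh _ _ (sP x); exists i; rewrite -si.
by apply: bset_ex => i; apply: bset_and => //; exact: (bset_comp mB (mh i)).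
Qed.

(* The countably many functions [g] play the role of the Lusin-Novikov
   uniformizing functions of a countable Borel equivalence relation: they make
   quantification over a class measurable. *)
Record generated d (X : measurableType d) (F : X -> X -> Prop)
    (g : nat -> X -> X) : Prop := Generated {
  gen_refl : forall x, F x x;
  gen_sym : forall x y, F x y -> F y x;
  gen_trans : forall x y z, F x y -> F y z -> F x z;
  gen_brel : brel F;
  gen_bfun : forall i, bfun (g i);
  gen_inj : forall i, injective (g i);
  gen_cover : forall x y, F x y -> exists i, y = g i x
}.

(** * Relations covered by countably many Borel injections *)

Section Generated.
Local Open Scope classical_set_scope.
Context d (X : measurableType d) (F : X -> X -> Prop) (g : nat -> X -> X).
Hypothesis genF : generated F g.

Lemma bset_exF (R : X -> X -> Prop) (u : X -> X) : bfun u ->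
  (forall i, bset (fun x => R x (g i (u x)))) ->
  bset (fun x => exists y, F (u x) y /\ R x y).
Proof.
move=> mu mR.
apply: (bset_ext (Q := fun x => exists i, F (u x) (g i (u x)) /\ R x (g i (u x)))).
  move=> x; split=> [[y [Fy Ry]]|[i [? ?]]]; last by exists (g i (u x)).
  by have [i yE] := gen_cover genF Fy; exists i; rewrite -yE.
apply: bset_ex => i; apply: bset_and => //.
by apply: gen_brel genF _ _ _ _ => //; apply: bfun_comp => //; apply: gen_bfun genF _.
Qed.

Lemma measurable_graph (R : X -> X -> Prop) : brel R ->
  (forall x, exists y, R x y) -> (forall x y, R x y -> F x y) ->
  (forall x y y', R x y -> R x y' -> y = y') ->
  exists2 s : X -> X, bfun s & forall x y, s x = y <-> R x y.
Proof.
move=> mR totR RF funR; apply: (measurable_graph_cover (gen_bfun genF)) => //.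
  by move=> i; apply: mR; [exact: bfun_id|exact: (gen_bfun genF i)].
by move=> x y /RF; exact: (gen_cover genF).
Qed.

End Generated.

Ltac bset_connectives :=
  repeat match goal with
  | |- bset (fun=> ?p) => exact: (bset_const _ p)
  | |- bset (fun x => _ /\ _) => apply: bset_and
  | |- bset (fun x => _ \/ _) => apply: bset_or
  | |- bset (fun x => ~ _) => apply: bset_not
  | |- bset (fun x => exists n : nat, _) => apply: bset_ex => ?
  | |- bset (fun x => exists n : 'I_ _, _) => apply: bset_ex => ?
  | |- bset (fun x => forall n : nat, _) => apply: bset_all => ?
  | |- bset (fun x => forall n : 'I_ _, _) => apply: bset_all => ?
  | |- bset (fun x => _ -> _) => apply: bset_imp
  end.

(** * Successors in a set of numbers and Hilbert's hotel *)

Definition next (K : nat -> Prop) k k' :=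
  [/\ K k', k < k' & forall j, k < j -> j < k' -> ~ K j].

Lemma next_exists (K : nat -> Prop) k :
  (exists k', k < k' /\ K k') -> exists k', next K k k'.
Proof.
move=> exK; have {exK} : exists k', (k < k') && `[< K k' >].
  by have [k' [kk' Kk']] := exK; exists k'; rewrite kk'; apply/asboolP.
move=> exK; case: (ex_minnP exK) => k' /andP[kk' /asboolP Kk'] mink'.
exists k'; split=> // j kj jk' /asboolP Kj.
by have := mink' j; rewrite kj Kj leqNgt jk' => /(_ isT).
Qed.

Lemma prev_exists (K : nat -> Prop) k :
  K 0 -> 0 < k -> K k -> exists2 j, K j & next K j k.
Proof.
move=> K0 k0 Kk; have exK : exists j, (j < k) && `[< K j >].
  by exists 0; rewrite k0; apply/asboolP.
have bK j : (j < k) && `[< K j >] -> j <= k by case/andP => /ltnW.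
case: (ex_maxnP exK bK) => j /andP[jk /asboolP Kj] maxj.
exists j => //; split=> // i ji ik /asboolP Ki.
by have := maxj i; rewrite ik Ki leqNgt ji => /(_ isT).
Qed.

Lemma next_inj (K : nat -> Prop) j j' k :
  K j -> K j' -> next K j k -> next K j' k -> j = j'.
Proof.
move=> Kj Kj' [_ jk nj] [_ j'k nj'].
by case: (ltngtP j j') => // lt; [case: (nj j')|case: (nj' j)].
Qed.

Lemma next_fun (K : nat -> Prop) j k k' :
  next K j k -> next K j k' -> k = k'.
Proof.
move=> [Kk jk nk] [Kk' jk' nk'].
by case: (ltngtP k k') => // lt; [case: (nk' k)|case: (nk k')].
Qed.

Section Shift.
Context d (X : measurableType d) (F : X -> X -> Prop) (g : nat -> X -> X).
Hypothesis genF : generated F g.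
Hypothesis meq : brel (@eq X).

(* Hilbert's hotel: each [d] in [D] starts the infinite sequence of the points
   [e k d], [k] in [K], and every point of it is moved to the next one. *)
Lemma shift_exists (D : X -> Prop) (K : nat -> X -> Prop) (e : nat -> X -> X) :
  (forall k, bset (K k)) -> (forall k, bfun (e k)) ->
  (forall x, D x <-> K 0 x) -> (forall k x, K k x -> D x) ->
  (forall x, D x -> forall j, exists k, j < k /\ K k x) ->
  (forall x, D x -> e 0 x = x) -> (forall k x, K k x -> F x (e k x)) ->
  (forall k x l y, K k x -> K l y -> e k x = e l y -> k = l /\ x = y) ->
  exists S : X -> X,
    [/\ bfun S, injective S, forall x, F x (S x),
        forall y, (exists x, S x = y) <-> ~ D y &
        forall x, S x = x \/
          exists z k l, [/\ K k z, K l z, 0 < l, x = e k z & S x = e l z]].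
Proof.
move=> mK me DK KD infK e0 eF einj.
(* [onK] collects the points lying on some sequence, and [R] is the graph of the shift, the identity
   off the sequences. The conjunct [F x z] confines the quantifier to an [F]-class and so keeps it
   Borel. *)
pose onK x := exists z, F x z /\ exists k, K k z /\ x = e k z.
pose move_to x y z := exists k l, [/\ K k z, next (K ^~ z) k l, x = e k z & y = e l z].
pose R x y := (exists z, F x z /\ move_to x y z) \/ (~ onK x /\ y = x).
have onKe k x : K k x -> onK (e k x).
  by move=> Kx; exists x; split; [apply: gen_sym genF _ _ _; apply: eF|exists k].
have mR : brel R.
  move=> u v mu mv; have mgu i : bfun (fun x => g i (u x)).
    by apply: bfun_comp => //; apply: gen_bfun genF _.
  apply: bset_or; last apply: bset_and; last exact: meq.
    apply: (bset_exF genF) => // i; apply: bset_ex => k; apply: bset_ex => l.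
    pose z x := g i (u x); have mz : bfun z by exact: mgu.
    apply: (bset_ext (Q := fun x => K k (z x) /\ ((K l (z x) /\ (k < l /\
        forall j, k < j -> j < l -> ~ K j (z x))) /\
        (u x = e k (z x) /\ v x = e l (z x))))) => [x|].
      by split=> [[? [? ? ?] ? ?]|[? [[? [? ?]] [? ?]]]].
    have mKz j : bset (fun x => K j (z x)) by exact: (bset_comp (mK j) mz).
    have mez j : bfun (fun x => e j (z x)) by apply: bfun_comp.
    by bset_connectives => //; apply: meq.
  apply: bset_not; apply: (bset_exF genF) => // i; apply: bset_ex => k.
  apply: bset_and; first exact: (bset_comp (mK k) (mgu i)).
  by apply: meq => //; apply: bfun_comp.
have RF x y : R x y -> F x y.
  move=> [[z [_ [k [l [Kk [Kl _ _] -> ->]]]]]|[_ ->]]; last exact: gen_refl genF _.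
  by apply: (gen_trans genF _ (eF _ _ Kl)); apply: gen_sym genF _ _ (eF _ _ Kk).
have totR x : exists y, R x y.
  have [[z [xz [k [Kk xE]]]]|nx] := pselect (onK x); last by exists x; right.
  have [l kl] := next_exists (infK _ (KD _ _ Kk) k).
  by exists (e l z); left; exists z; split=> //; exists k, l.
have funR x y y' : R x y -> R x y' -> y = y'.
  move=> [[z [_ [k [l [Kk kl -> ->]]]]]|[nx ->]].
    move=> [[z' [_ [k' [l' [Kk' kl' xE ->]]]]]|[nx _]].
      have [kk' zz'] := einj _ _ _ _ Kk Kk' xE; rewrite -kk' -zz' in kl' *.
      by rewrite (next_fun kl kl').
    by case: nx; apply: onKe.
  move=> [[z' [_ [k' [l' [Kk' kl' xE _]]]]]|[_ ->//]].
  by case: nx; rewrite xE; apply: onKe.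
have [S mS SR] := measurable_graph genF mR totR RF funR.
have SxR x : R x (S x) by apply/SR.
exists S; split=> //.
- move=> x x' Sxx'; have := SxR x; have := SxR x'; rewrite -Sxx'.
  move=> [[z [_ [k [l [Kk kl -> ->]]]]]|[nx ->]].
    move=> [[z' [_ [k' [l' [Kk' kl' ->]]]]]|[nx xE]].
      have [Kl _ _] := kl; have [Kl' _ _] := kl'.
      move=> /(einj _ _ _ _ Kl Kl')[ll' zz']; rewrite -ll' -zz' in kl' Kk' *.
      by rewrite (next_inj Kk Kk' kl kl').
    by case: nx; rewrite -xE; apply: onKe; case: kl.
  move=> [[z' [_ [k' [l' [Kk' kl' -> x'E]]]]]|[_ ->//]].
  by case: nx; rewrite x'E; apply: onKe; case: kl'.
- by move=> x; apply: RF.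
- move=> y; split=> [[x Sxy] Dy|nDy].
    have Ky : K 0 y by apply/DK.
    have := SxR x; rewrite Sxy => -[[z [_ [k [l [Kk [Kl kl _] _]]]]]|[nx yx]].
      rewrite -[y in y = _](e0 _ Dy) => /(einj _ _ _ _ Ky Kl)[l0 _].
      by rewrite -l0 in kl.
    by case: nx; rewrite -yx -(e0 _ Dy); apply: onKe.
  (* A point of a sequence that is not in [D] has index [k > 0], so it is reached from the preceding
     index in [K]. *)
  have [[z [yz [k [Kk yE]]]]|ny] := pselect (onK y); last first.
    by exists y; apply/SR; right.
  have Dz := KD _ _ Kk; have K0 : K 0 z by apply/DK.
  have k0 : 0 < k.
    by case: k Kk yE => [|//] _ yE; case: nDy; rewrite yE e0.
  have [j Kj jk] := prev_exists (K := K ^~ z) K0 k0 Kk.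
  exists (e j z); apply/SR; left; exists z; split; last by exists j, k.
  by apply: gen_sym genF _ _ (eF _ _ Kj).
- move=> x; have [[z [_ [k [l [Kk [Kl kl _] xE SxE]]]]]|[]] := SxR x; last by left.
  by right; exists z, k, l; split=> //; apply: leq_ltn_trans kl.
Qed.

End Shift.

(** The nonempty fibres of [pi] cut every [F]-class into sets meeting each of its [E]-classes
    exactly once. The value [pi x] is only a name for the fibre and need not belong to it. *)
Record transversal_map d (X : measurableType d) (E F : X -> X -> Prop)
    (pi : X -> X) : Prop := TransversalMap {
  tr_bfun : bfun pi;
  tr_rel : forall x, F x (pi x);
  tr_inj : forall x y, E x y -> pi x = pi y -> x = y;
  tr_surj : forall x y, F x y -> exists z, E z x /\ pi z = pi y
}.

(** Cancel [f] on both sides until one exponent is 0; the other is then 0 too, because a point of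
    [W] is never a value of [f]. *)
Lemma iter_inj (X : Type) (f : X -> X) (W : X -> Prop) :
  injective f -> (forall x, ~ W (f x)) ->
  forall k x l y, W x -> W y -> iter k f x = iter l f y -> k = l /\ x = y.
Proof.
move=> fI fW; elim=> [|k IH] x [|l] y Wx Wy //=.
- by move=> xE; rewrite xE in Wx; case: (fW _ Wx).
- by move=> yE; rewrite -yE in Wy; case: (fW _ Wy).
- by move/fI/IH => /(_ Wx Wy)[-> ->].
Qed.

(** * Existence of a Borel partition into transversals for a finite extension *)

Section TransversalExists.
Context d (X : measurableType d) (E F : X -> X -> Prop) (g : nat -> X -> X).
Hypothesis genE : generated E g.
Hypothesis genF : generated F g.
Hypothesis EF : forall x y, E x y -> F x y.
Context (V : nat -> set X).
Hypothesis sepV : separating V.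
Context (m : nat) (T : 'I_m -> X -> X).
Hypothesis T_bfun : forall n, bfun (T n).
Hypothesis T_inj : forall n, injective (T n).
Hypothesis T_E : forall n x y, E x y -> E (T n x) (T n y).
Hypothesis T_F : forall n x, F x (T n x).
Hypothesis F_T : forall x y, F x y -> exists n, E (T n x) y.

Let meq : brel (@eq X) := brel_eq sepV.
Let E_refl := gen_refl genE.
Let E_sym := gen_sym genE.
Let E_trans := gen_trans genE.
Let F_sym := gen_sym genF.
Let F_trans := gen_trans genF.

Let code : Type := ({ffun 'I_m -> nat} * {ffun 'I_m * 'I_m -> nat})%type.

(* [c] codes the finite set of the points [g (c.1 n) b]; the sets [V (c.2 _)]
   separate them, which makes the sets coded by [c] for distinct bases [b]
   disjoint. *)
Let cond (c : code) (b : X) : Prop :=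
  [/\ (forall n : 'I_m, E (T n b) (g (c.1 n) b)), (exists n : 'I_m, g (c.1 n) b = b) &
    forall n n' : 'I_m, g (c.1 n) b = g (c.1 n') b \/
      ~ E (g (c.1 n) b) (g (c.1 n') b) /\
      (V (c.2 (n, n')) (g (c.1 n) b) /\ ~ V (c.2 (n, n')) (g (c.1 n') b))].

Let cond_bset c : bset (cond c).
Proof.
apply: (bset_ext (Q := fun b => (forall n : 'I_m, E (T n b) (g (c.1 n) b)) /\
   ((exists n : 'I_m, g (c.1 n) b = b) /\
    forall n n' : 'I_m, g (c.1 n) b = g (c.1 n') b \/
      ~ E (g (c.1 n) b) (g (c.1 n') b) /\
      (V (c.2 (n, n')) (g (c.1 n) b) /\ ~ V (c.2 (n, n')) (g (c.1 n') b))))).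
  by move=> x; split=> [[? ? ?]|[? [? ?]]].
have mg := gen_bfun genE; have mE := gen_brel genE; have [mV _] := sepV.
bset_connectives.
- by apply: mE.
- by apply: meq => //; exact: bfun_id.
- exact: meq.
- exact: mE.
- exact: (bset_comp (mV _) (mg _)).
- exact: (bset_comp (mV _) (mg _)).
Qed.

(** Here [z] is a point and [b] the base of its block. Stage [j] adds simultaneously all blocks with
    code number [j] that avoid the earlier ones; sharing one code keeps the new blocks disjoint from
    each other. *)
Fixpoint blocks (k : nat) (z b : X) : Prop :=
  if k is j.+1 then blocks j z b \/ exists c : code,
    unpickle j = Some c /\ cond c b /\ (exists n : 'I_m, z = g (c.1 n) b) /\
    forall n : 'I_m, ~ exists b', F (g (c.1 n) b) b' /\ blocks j (g (c.1 n) b) b'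
  else False.

Let blocks_brel k : brel (blocks k).
Proof.
elim: k => [|k IH] u v mu mv /=; first exact: bset_const.
have mg i : bfun (fun x => g i (v x)).
  by apply: bfun_comp => //; apply: gen_bfun genE _.
apply: bset_or; first exact: IH.
apply: bset_ex => c; bset_connectives.
- exact: (bset_comp (cond_bset c) mv).
- exact: meq.
- apply: (bset_exF genF) => // i; apply: IH => //.
  by apply: bfun_comp => //; apply: gen_bfun genE _.
Qed.

Let block_F c b n : cond c b -> F b (g (c.1 n) b).
Proof. by case=> /(_ n)/EF cE _ _; apply: F_trans (T_F n b) cE. Qed.

Let blocks_F k z b : blocks k z b -> F z b.
Proof.
by elim: k => [//|k IH] /= [/IH//|[c [_ [cb [[n ->] _]]]]]; apply/F_sym/block_F.
Qed.

Let blocks_mono j k z b : j <= k -> blocks j z b -> blocks k z b.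
Proof. by move=> /subnK <-; elim: (k - j) => //= n IH /IH; left. Qed.

Let blocks_fun k z b b' : blocks k z b -> blocks k z b' -> b = b'.
Proof.
elim: k => [//|k IH] /= [bb|[c [cE [cb [[n zn] nb]]]]]
  [bb'|[c' [c'E [cb' [[n' zn'] nb']]]]].
- exact: IH bb bb'.
- case: (nb' n'); exists b; rewrite -zn'; split=> //; exact: blocks_F bb.
- case: (nb n); exists b'; rewrite -zn; split=> //; exact: blocks_F bb'.
(* Both blocks have the same code. Unless injectivity of some [g i] gives [b = b'], the set of [V]
   attached to [(n, n')] contains [z] on account of [b] and omits [z] on account of [b']. *)
- move: c'E; rewrite cE => -[cc']; rewrite -cc' in cb' zn' {nb'}.
  have gI := gen_inj genE.
  have [_ _ /(_ n n')[gE|[_ [Vn _]]]] := cb.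
    by apply: (gI (c.1 n')); rewrite -zn' -gE.
  have [_ _ /(_ n n')[gE|[_ [_ nVn']]]] := cb'.
    by apply: (gI (c.1 n)); rewrite gE -zn' -zn.
  by case: nVn'; rewrite -zn' zn.
Qed.

Let blocks_base k z b : blocks k z b -> blocks k b b.
Proof.
elim: k => [//|k IH] /= [/IH|[c [cE [cb [zn nb]]]]]; [by left|right].
exists c; do !split=> //; have [_ [n0 n0E] _] := cb; by exists n0.
Qed.

Let blocks_E k z z' b : blocks k z b -> blocks k z' b -> E z z' -> z = z'.
Proof.
(* A base belongs to its own block, so once used it is covered and cannot be the base of a later
   block. *)
have new j y c : blocks j y b -> cond c b ->
    (forall n, ~ exists b', F (g (c.1 n) b) b' /\ blocks j (g (c.1 n) b) b') -> False.
  move=> /blocks_base bb [_ [n0 n0E] _] /(_ n0); apply; exists b.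
  by rewrite n0E; split=> //; apply: gen_refl genF _.
elim: k => [//|k IH] /= [bz|[c [cE [cb [[n zn] nb]]]]]
  [bz'|[c' [c'E [cb' [[n' zn'] nb']]]]] zz'.
- exact: IH bz bz' zz'.
- by case: (new _ _ _ bz cb' nb').
- by case: (new _ _ _ bz' cb nb).
- move: c'E; rewrite cE => -[cc']; rewrite -cc' in zn'.
  have [_ _ /(_ n n')[gE|[nE _]]] := cb; first by rewrite zn gE -zn'.
  by case: nE; rewrite -zn -zn'.
Qed.

Let blocks_surj k z b y : blocks k z b -> F y z -> exists z', E z' y /\ blocks k z' b.
Proof.
elim: k => [//|k IH] /= [/IH h|[c [cE [cb [[n zn] nb]]]]] yz.
  by have [z' [? ?]] := h yz; exists z'; split=> //; left.
have [n' Tn'] : exists n', E (T n' b) y.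
  by apply: F_T; apply: F_sym; apply: F_trans yz _; rewrite zn; apply/F_sym/block_F.
exists (g (c.1 n') b); split; last first.
  by right; exists c; do !split=> //; exists n'.
by have [/(_ n')/E_sym cb' _ _] := cb; apply: E_trans cb' Tn'.
Qed.

Let block z b := exists k, blocks k z b.

Let block_brel : brel block.
Proof. by move=> u v mu mv; apply: bset_ex => k; apply: blocks_brel. Qed.

Let block_rel z b : block z b -> F z b.
Proof. by case=> k /blocks_F. Qed.

Let block_fun z b b' : block z b -> block z b' -> b = b'.
Proof.
move=> [k bk] [l bl]; apply: (@blocks_fun (maxn k l) z).
  exact: blocks_mono (leq_maxl k l) bk.
exact: blocks_mono (leq_maxr k l) bl.
Qed.

Let block_E z z' b : block z b -> block z' b -> E z z' -> z = z'.
Proof.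
move=> [k bk] [l bl]; apply: (@blocks_E (maxn k l) z z' b).
  exact: blocks_mono (leq_maxl k l) bk.
exact: blocks_mono (leq_maxr k l) bl.
Qed.

Let block_surj z b y : block z b -> F y z -> exists z', E z' y /\ block z' b.
Proof.
by move=> [k bk] /(blocks_surj bk)[z' [? ?]]; exists z'; split=> //; exists k.
Qed.

Let W z := ~ exists b, F z b /\ block z b.

Let W_bset (u : X -> X) : bfun u -> bset (fun x => W (u x)).
Proof.
move=> mu; apply/bset_not/(bset_exF genF) => // i; apply: block_brel => //.
by apply: bfun_comp => //; apply: gen_bfun genE _.
Qed.

Let WP z : ~ W z -> exists b, block z b.
Proof. by move=> /contrapT[b [_ ?]]; exists b. Qed.

Let misses n x := forall w, E (T n x) w -> ~ W w.

(** By maximality: if every [E]-class of the [F]-class of [x] had an uncovered point, one such point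
    per class would form a block avoiding all others, which would have been added at the stage of
    its code. *)
Let misses_exists x : exists n, misses n x.
Proof.
apply: contrapT => /forallNP nm.
(* The default [x] is the same for all [y], so the chosen point depends only on the [E]-class of
   [y]. *)
pose r y := xget x [set w | E y w /\ W w].
have rE y y' : E y y' -> r y = r y'.
  move=> yy'; congr (xget x _); apply/seteqP; split=> a /= [h Wa]; split=> //.
    exact: E_trans (E_sym yy') h.
  exact: E_trans yy' h.
have rW y : (exists w, E y w /\ W w) -> E y (r y) /\ W (r y).
  by move=> [w wP]; rewrite /r; case: xgetP => [a _ //|/(_ w) []].
have exT n : exists w, E (T n x) w /\ W w.
  by apply: contrapT => nw; apply: (nm n) => w Tw Ww; apply: nw; exists w.
have [n0 n0x] : exists n, E (T n x) x by apply: F_T; apply: gen_refl genF _.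
have exx : exists w, E x w /\ W w.
  have [w [? ?]] := exT n0; exists w; split=> //.
  by apply: E_trans (E_sym n0x) _.
pose b := r x; have [xb Wb] := rW _ exx.
have exb n : exists w, E (T n b) w /\ W w.
  have [w [? ?]] := exT n; exists w; split=> //.
  by apply: E_trans (E_sym (T_E n xb)) _.
pose w n := r (T n b); have wP n := rW _ (exb n).
have wn0 : w n0 = b.
  rewrite /w /b; apply/esym/rE; apply: E_sym.
  apply: E_trans _ (n0x); exact: E_sym (T_E n0 xb).
have wE n n' : E (w n) (w n') -> w n = w n'.
  move=> ww'; apply: rE; apply: E_trans (wP n).1 _.
  exact: E_trans ww' (E_sym (wP n').1).
have /choice[i iE] n : exists i, w n = g i b.
  by apply: (gen_cover genF); apply: F_trans (T_F n b) (EF (wP n).1).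
have /choice[v vP] p : exists k, w p.1 <> w p.2 -> V k (w p.1) /\ ~ V k (w p.2).
  have [->|ne] := pselect (w p.1 = w p.2); first by exists 0.
  by have [k kP] := sepV.2 _ _ ne; exists k.
pose c : code := ([ffun n => i n], [ffun p => v p]).
have cE n : g (c.1 n) b = w n by rewrite /c /= ffunE -iE.
have bc : cond c b.
  split=> [n||n n']; first by rewrite cE; case: (wP n).
    by exists n0; rewrite cE.
  rewrite !cE; have [|ne] := pselect (w n = w n'); first by left.
  by right; split=> [/wE//|]; rewrite /c /= ffunE; apply: (vP (n, n')).
have bb : block b b.
  exists (pickle c).+1; right; exists c; rewrite pickleK; do !split=> //.
    by exists n0; rewrite cE.
  move=> n [b' [_ bk]]; rewrite cE in bk; case: (wP n) => _; apply.
  by exists b'; split; [apply: blocks_F bk|exists (pickle c)].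
by case: Wb; exists b; split=> //; apply: gen_refl genF _.
Qed.

Let misses_bset n (u : X -> X) : bfun u -> bset (fun x => misses n (u x)).
Proof.
move=> mu; apply: (bset_ext (Q := fun x => ~ exists y, E (T n (u x)) y /\ W y)).
  by move=> x; rewrite /misses; split=> [h [y [/h]]//|h y ? ?]; apply: h; exists y.
have mTu : bfun (fun x => T n (u x)) by exact: bfun_comp.
apply: bset_not; apply: (bset_exF genE) => // i.
by apply: W_bset; apply: bfun_comp => //; apply: gen_bfun genE _.
Qed.

Let misses_E n x y : E x y -> misses n x -> misses n y.
Proof. by move=> xy h w yw; apply: h; apply: E_trans (T_E n xy) yw. Qed.

(** Taking the least index makes the covered class chosen for [x] depend only on the [E]-class of
    [x]; the injectivity of the compression rests on this. *)
Let level (n : 'I_m) x := misses n x /\ forall j : 'I_m, j < n -> ~ misses j x.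

Let level_exists x : exists n, level n x.
Proof.
have [n0 n0P] := misses_exists x.
pose p n := `[< misses n x >]; have p0 : p n0 by apply/asboolP.
case: (arg_minnP (fun n : 'I_m => val n) p0) => n /asboolP nx minn.
exists n; split=> // j jn /asboolP jx; have := minn j jx.
by rewrite leqNgt jn.
Qed.

Let level_E n n' x y : E x y -> level n x -> level n' y -> n = n'.
Proof.
move=> xy [nx ltn] [ny ltn']; apply/val_inj.
case: (ltngtP n n') => // lt.
  by case: (ltn' _ lt); apply: misses_E nx.
by case: (ltn _ lt); apply: misses_E (E_sym xy) ny.
Qed.

(* A class [C] is sent through [T n] to an [E]-class of the same [F]-class that
   is entirely covered by blocks, and then back along the blocks into [C]. *)
Lemma covered_injection : exists f : X -> X,
  [/\ bfun f, injective f, forall x, E x (f x) & forall x, ~ W (f x)].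
Proof.
pose R x y := E x y /\ exists n : 'I_m, level n x /\
  exists b, F x b /\ (block (T n x) b /\ block y b).
have mR : brel R.
  move=> u v mu mv; have mE := gen_brel genE.
  rewrite /R /level; bset_connectives; [exact: mE|exact: misses_bset|exact: misses_bset|].
  apply: (bset_exF genF) => // i.
  have mg : bfun (fun x => g i (u x)) by apply: bfun_comp => //; apply: gen_bfun genE _.
  by apply: bset_and; apply: block_brel => //; apply: bfun_comp.
have totR x : exists y, R x y.
  have [n nx] := level_exists x; have [mx _] := nx.
  have [b bT] : exists b, block (T n x) b by apply: WP; apply: mx; apply: E_refl.
  have [y [yx yb]] := block_surj bT (T_F n x).
  exists y; split; first exact: E_sym.
  exists n; split=> //; exists b; split=> //.
  exact: F_trans (T_F n x) (block_rel bT).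
have RE x y : R x y -> E x y by case.
have funR x y y' : R x y -> R x y' -> y = y'.
  move=> [xy [n [nx [b [_ [bT yb]]]]]] [xy' [n' [nx' [b' [_ [bT' yb']]]]]].
  have nn' := level_E (E_refl x) nx nx'; rewrite -nn' in bT'.
  rewrite -(block_fun bT bT') in yb'; apply: block_E yb yb' _.
  exact: E_trans (E_sym xy) xy'.
have [f mf fR] := measurable_graph genE mR totR RE funR.
have fRx x : R x (f x) by apply/fR.
exists f; split=> //; first last.
- move=> x; have [_ [n [_ [b [_ [_ fb]]]]]] := fRx x; apply; exists b.
  by split=> //; apply: block_rel.
- by move=> x; apply: RE.
move=> x x' ff'.
have [xf [n [nx [b [_ [bT fb]]]]]] := fRx x.
have [xf' [n' [nx' [b' [_ [bT' fb']]]]]] := fRx x'.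
rewrite -ff' in xf' fb'.
have xx' := E_trans xf (E_sym xf').
have nn' := level_E xx' nx nx'; rewrite -nn' in bT'.
rewrite -(block_fun fb fb') in bT'.
by apply: (@T_inj n); apply: block_E bT bT' _; apply: T_E.
Qed.

(** The compression [f] starts an infinite orbit at each uncovered point. Shifting along these
    orbits gives an injection [S] inside the [E]-classes whose range is exactly the covered part,
    and [pi] is the pullback of the block partition by [S]. *)
Lemma transversal_map_exists : exists pi, transversal_map E F pi.
Proof.
have [f [mf fI fE fW]] := covered_injection.
have [S [mS SI SE SW _]] : exists S : X -> X,
    [/\ bfun S, injective S, forall x, E x (S x),
        forall y, (exists x, S x = y) <-> ~ W y &
        forall x, S x = x \/
          exists z k l, [/\ W z, W z, 0 < l, x = iter k f z & S x = iter l f z]].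
  apply: (shift_exists genE meq (D := W) (K := fun=> W) (e := fun k => iter k f)) => //.
  - by move=> _; apply: W_bset; exact: bfun_id.
  - by move=> k; apply: bfun_iter.
  - by move=> x Wx j; exists j.+1.
  - move=> k x _; elim: k => [|k IH] /=; first exact: E_refl.
    exact: E_trans IH (fE _).
  - by move=> k x l y Wx Wy; apply: (iter_inj fI fW).
have SU x : exists b, block (S x) b by apply: WP; apply/SW; exists x.
have [] := measurable_graph genF (R := fun x b => block (S x) b) => //.
- by move=> u v mu mv; apply: block_brel => //; apply: bfun_comp.
- by move=> x b /block_rel; apply: F_trans; apply: EF.
- by move=> x b b'; apply: block_fun.
move=> pi mpi piP; have pix x : block (S x) (pi x) by apply/piP.
exists pi; split=> //.
- by move=> x; apply: F_trans (EF (SE x)) (block_rel (pix x)).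
- move=> x y xy pixy; apply: SI; apply: (@block_E _ _ (pi x)) => //.
    by rewrite pixy.
  exact: E_trans (E_sym (SE x)) (E_trans xy (SE y)).
- move=> x y xy; have [z' [z'x bz']] : exists z', E z' x /\ block z' (pi y).
    by apply: block_surj (pix y) _; apply: F_trans xy (EF (SE y)).
  have [z zE] : exists z, S z = z'.
    by apply/SW; apply; exists (pi y); split=> //; apply: block_rel.
  exists z; split; last by apply/piP; rewrite zE.
  by apply: E_trans (SE z) _; rewrite zE.
Qed.

End TransversalExists.

(** Otherwise every value stops occurring from some index on, and an index beyond all these bounds
    has no value left to take. *)
Lemma infinite_pigeonhole (m : nat) (c : nat -> nat) : (forall k, c k < m) ->
  exists2 n, n < m & forall j, exists k, j < k /\ c k = n.
Proof.
move=> cm; apply: contrapT => h.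
have /choice[j jP] (n : 'I_m) : exists j, forall k, j < k -> c k <> n.
  apply: contrapT => nj; apply: h; exists n; rewrite ?ltn_ord// => j.
  apply: contrapT => nk; apply: nj; exists j => k jk ck; apply: nk.
  by exists k.
pose k := (\max_(n < m) j n).+1.
by apply: (jP (Ordinal (cm k)) k) => //; rewrite ltnS; apply: leq_bigmax.
Qed.

Record partial_matching d (X : measurableType d) (F H : X -> X -> Prop)
    (A B : X -> Prop) : Prop := PartialMatching {
  pm_brel : brel H;
  pm_dom : forall x y, H x y -> A x;
  pm_ran : forall x y, H x y -> B y;
  pm_rel : forall x y, H x y -> F x y;
  pm_fun : forall x y y', H x y -> H x y' -> y = y';
  pm_inj : forall x x' y, H x y -> H x' y -> x = x'
}.

(** * Maximal Borel matchings inside a relation *)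

Section MaximalMatching.
Context d (X : measurableType d) (F : X -> X -> Prop) (g : nat -> X -> X).
Hypothesis genF : generated F g.
Hypothesis meq : brel (@eq X).

Lemma partial_matching_sym (H : X -> X -> Prop) (A B : X -> Prop) :
  partial_matching F H A B -> partial_matching F (fun x y => H y x) B A.
Proof.
case=> mH HA HB HF Hfun Hinj; split.
- by move=> u v mu mv; apply: mH.
- by move=> x y /HB.
- by move=> x y /HA.
- by move=> x y /HF; apply: gen_sym genF _ _.
- by move=> x y y'; apply: Hinj.
- by move=> x x' y; apply: Hfun.
Qed.

Variables (A B : X -> Prop).
Hypotheses (mA : bset A) (mB : bset B).

(** Stage [j] tries to join [x] to [g j x] and succeeds when both are still free. As [g j] is
    injective, pairs joined at the same stage do not collide. *)
Fixpoint greedy (k : nat) (x y : X) : Prop :=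
  if k is j.+1 then greedy j x y \/
    [/\ A x /\ B y, F x y, y = g j x,
        ~ (exists y', F x y' /\ greedy j x y') &
        ~ (exists x', F y x' /\ greedy j x' y)]
  else False.

Lemma maximal_matching : exists H, partial_matching F H A B /\
  forall x y, A x -> B y -> F x y -> (exists y', H x y') \/ (exists x', H x' y).
Proof.
have [F_sym F_trans] := (gen_sym genF, gen_trans genF).
have mk k : brel (greedy k).
  elim: k => [|k IH] u v mu mv /=; first exact: bset_const.
  have mg j w : bfun w -> bfun (fun x => g j (w x)).
    by move=> mw; apply: bfun_comp => //; apply: gen_bfun genF _.
  apply: bset_or; first exact: IH.
  pose P x := exists y', F (u x) y' /\ greedy k (u x) y'.
  pose Q x := exists x', F (v x) x' /\ greedy k x' (v x).
  apply: (bset_ext (Q := fun x => (A (u x) /\ B (v x)) /\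
    (F (u x) (v x) /\ (v x = g k (u x) /\ (~ P x /\ ~ Q x))))).
    by move=> x; split=> [[]|[? [? [? []]]]].
  bset_connectives.
  - exact: (bset_comp mA mu).
  - exact: (bset_comp mB mv).
  - exact: (gen_brel genF).
  - by apply: meq => //; apply: mg.
  - by apply: (bset_exF genF) => // i; apply: IH => //; apply: mg.
  - by apply: (bset_exF genF) => // i; apply: IH => //; apply: mg.
have mono j k x y : j <= k -> greedy j x y -> greedy k x y.
  by move=> /subnK <-; elim: (k - j) => //= n IH /IH; left.
have gF k x y : greedy k x y -> F x y.
  by elim: k => [//|k IH] /= [/IH//|[]].
have gfun k x y y' : greedy k x y -> greedy k x y' -> y = y'.
  elim: k => [//|k IH] /= [xy|[_ _ yE n1 n2]] [xy'|[_ _ y'E n1' n2']].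
  - exact: IH xy xy'.
  - by case: n1'; exists y; split=> //; apply: gF xy.
  - by case: n1; exists y'; split=> //; apply: gF xy'.
  - by rewrite yE.
have ginj k x x' y : greedy k x y -> greedy k x' y -> x = x'.
  elim: k => [//|k IH] /= [xy|[_ _ yE n1 n2]] [xy'|[_ _ y'E n1' n2']].
  - exact: IH xy xy'.
  - by case: n2'; exists x; split=> //; apply/F_sym/gF/xy.
  - by case: n2; exists x'; split=> //; apply/F_sym/gF/xy'.
  - by apply: (@gen_inj _ _ _ _ genF k); rewrite -yE.
exists (fun x y => exists k, greedy k x y); split.
  split.
  - by move=> u v mu mv; apply: bset_ex => k; apply: mk.
  - by move=> x y [k]; elim: k => [//|k IH] /= [/IH//|[[]]].
  - by move=> x y [k]; elim: k => [//|k IH] /= [/IH//|[[]]].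
  - by move=> x y [k /gF].
  - move=> x y y' [k xy] [l xy']; apply: (@gfun (maxn k l) x).
      exact: mono (leq_maxl k l) xy.
    exact: mono (leq_maxr k l) xy'.
  - move=> x x' y [k xy] [l xy']; apply: (@ginj (maxn k l) x x' y).
      exact: mono (leq_maxl k l) xy.
    exact: mono (leq_maxr k l) xy'.
move=> x y Ax By xy; apply: contrapT => /not_orP[nx ny].
have [i yE] := gen_cover genF xy; apply: (nx); exists y, i.+1; right; split=> //.
  by move=> [y' [_ xy']]; apply: ny; case: nx; exists y', i.
by move=> [x' [_ x'y]]; apply: ny; exists x', i.
Qed.

End MaximalMatching.

(** * Absorbing the unmatched part of one side *)

Section Absorption.
Context d (X : measurableType d) (E F : X -> X -> Prop) (g : nat -> X -> X).
Hypothesis genE : generated E g.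
Hypothesis genF : generated F g.
Hypothesis EF : forall x y, E x y -> F x y.
Hypothesis meq : brel (@eq X).
Context (piA piB : X -> X) (kap : X -> nat) (m : nat).
Hypothesis trA : transversal_map E F piA.
Hypothesis trB : transversal_map E F piB.
Hypothesis idA : forall x, piA (piA x) = piA x.
Hypothesis idB : forall x, piB (piB x) = piB x.
Hypothesis mkap : forall n, bset (fun x => kap x = n).
Hypothesis kapm : forall x, kap x < m.
Hypothesis kapI : forall x y, piB x = piB y -> kap x = kap y -> x = y.
Let A x := piA x = x.
Let B x := piB x = x.
Context (H : X -> X -> Prop).
Hypothesis pmH : partial_matching F H A B.
Hypothesis exhaustH : forall x y, B y -> ~ (exists a, H a y) -> A x -> F x y ->
  exists b, H x b.

Let F_refl := gen_refl genF.
Let F_sym := gen_sym genF.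
Let F_trans := gen_trans genF.
Let mpiA := tr_bfun trA.
Let mpiB := tr_bfun trB.

Let left_over y := B y /\ ~ exists a, F y a /\ H a y.
Let active x := exists y, F x y /\ left_over y.

Let left_over_bset u : bfun u -> bset (fun x => left_over (u x)).
Proof.
move=> mu; apply: bset_and; first by apply: meq => //; apply: bfun_comp.
apply/bset_not/(bset_exF genF) => // i; apply: (pm_brel pmH) => //.
by apply: bfun_comp => //; apply: gen_bfun genF _.
Qed.

Let active_bset u : bfun u -> bset (fun x => active (u x)).
Proof.
move=> mu; apply: (bset_exF genF) => // i; apply: left_over_bset => //.
by apply: bfun_comp => //; apply: gen_bfun genF _.
Qed.

Let active_F x y : F x y -> active x -> active y.
Proof. by move=> xy [z [xz Lz]]; exists z; split=> //; apply: F_trans (F_sym xy) xz. Qed.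

(* [H] lifts to the fibres of [piA] and [piB], because these meet every
   [E]-class of an [F]-class exactly once. *)
Let lift_exists : exists f : X -> X,
  [/\ bfun f, injective f, forall x, F x (f x) &
      forall x, active x -> ~ left_over (piB (f x))].
Proof.
pose R x y := (active x /\ (E x y /\ H (piA x) (piB y))) \/ (~ active x /\ y = x).
have mR : brel R.
  move=> u v mu mv; rewrite /R; bset_connectives.
  - exact: active_bset.
  - exact: (gen_brel genE).
  - by apply: (pm_brel pmH); apply: bfun_comp.
  - exact: active_bset.
  - exact: meq.
have RF x y : R x y -> F x y by case=> [[_ [/EF]]|[_ ->]].
have totR x : exists y, R x y.
  have [ax|nax] := pselect (active x); last by exists x; right.
  have [z [xz [Bz nz]]] := ax.
  have [b Hb] : exists b, H (piA x) b.
    apply: (exhaustH Bz) => [[a Ha]|//|]; last first.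
      exact: F_trans (F_sym (tr_rel trA x)) xz.
    by apply: nz; exists a; split=> //; apply: F_sym; apply: (pm_rel pmH Ha).
  have xb : F x b := F_trans (tr_rel trA x) (pm_rel pmH Hb).
  have [y [yx yb]] := tr_surj trB xb.
  have Bb : B b := pm_ran pmH Hb.
  exists y; left; do !split=> //; first exact: (gen_sym genE yx).
  by rewrite yb Bb.
have funR x y y' : R x y -> R x y' -> y = y'.
  move=> [[ax [xy Hy]]|[nax ->]] [[ax' [xy' Hy']]|[nax' ->]] //.
  apply: (tr_inj trB); last exact: (pm_fun pmH Hy Hy').
  exact: (gen_trans genE (gen_sym genE xy) xy').
have [f mf fR] := measurable_graph genF mR totR RF funR.
have fRx x : R x (f x) by apply/fR.
exists f; split=> //.
- move=> x x' ff'; have xf := RF _ _ (fRx x); have xf' := RF _ _ (fRx x').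
  rewrite -ff' in xf'; have xx' := F_trans xf (F_sym xf').
  have [[ax [xy Hy]]|[nax fx]] := fRx x.
    have [[ax' [xy' Hy']]|[nax' _]] := fRx x'; last first.
      by case: nax'; apply: active_F ax.
    rewrite -ff' in xy' Hy'; apply: (tr_inj trA).
      exact: (gen_trans genE xy (gen_sym genE xy')).
    exact: (pm_inj pmH Hy Hy').
  have [[ax' _]|[_ fx']] := fRx x'; first by case: nax; apply: active_F ax'; apply: F_sym.
  by rewrite -fx -fx'.
- by move=> x; apply: RF.
- move=> x ax; have [[_ [xy Hy]]|[]//] := fRx x; move=> [_]; apply.
  by exists (piA x); split=> //; apply: F_sym; apply: (pm_rel pmH Hy).
Qed.

(* In the classes where something is left over, the lift of [H] is an injection
   of the class into itself which misses the left-over part; the orbit of a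
   left-over point stays in one [E]-class and projects under [piB] to infinitely
   many points. Fixing the most frequent coordinate [kap] makes these sequences
   disjoint for distinct points, and one coordinate at a time is absorbed. *)
Lemma absorption : exists s : X -> X,
  [/\ bfun s, injective s, forall x, F x (s x) &
      forall y, (exists x, B x /\ s x = y) <-> exists a, H a y].
Proof.
have [f [mf fI fF fL]] := lift_exists.
have iterF k x : F x (iter k f x).
  by elim: k => [|k IH] //=; apply: F_trans IH (fF _).
have active_left x : left_over x -> active x by move=> Lx; exists x; split.
have iterL k x : left_over x -> ~ left_over (piB (iter k.+1 f x)).
  move=> Lx; apply: fL; apply: active_F (iterF k x) _; exact: active_left.
have fnL x : ~ left_over (f x).
  move=> Lfx; have [Bfx _] := Lfx; apply: (fL x); last by rewrite Bfx.
  apply: active_F (active_left _ Lfx); exact: F_sym.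
pose inf n x := forall j, exists k, j < k /\ kap (iter k f x) = n.
(* The index [n] is the least coordinate recurring infinitely often, which makes these sets
   disjoint; the pigeonhole at the end shows that those with [n < m] exhaust the left-over part. *)
pose Dn (n : nat) x := left_over x /\ (inf n x /\ forall n', n' < n -> ~ inf n' x).
pose Kn n k x := Dn n x /\ (k = 0 \/ kap (iter k f x) = n).
pose e k x := if k is j.+1 then piB (iter k f x) else x.
have Dn_fun n n' x : Dn n x -> Dn n' x -> n = n'.
  move=> [_ [nx ltn]] [_ [ny ltn']]; case: (ltngtP n n') => // lt.
    by case: (ltn' _ lt).
  by case: (ltn _ lt).
have mkapf n k : bset (fun x => kap (iter k f x) = n).
  by exact: (bset_comp (mkap n) (bfun_iter k mf)).
have minf n : bset (inf n) by rewrite /inf; bset_connectives.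
have mD n : bset (Dn n).
  rewrite /Dn; apply: bset_and; first by apply: left_over_bset; exact: bfun_id.
  by bset_connectives.
have e_left n k x : Kn n k x -> left_over (e k x) -> k = 0.
  by case: k => [//|k] [[Lx _] _] /(iterL k _ Lx).
have Be n k x : Kn n k x -> B (e k x).
  by case: k => [|k] [[[Bx _] _] _] //=; apply: idB.
have /choice[s sP] n : exists s : X -> X,
    [/\ bfun s, injective s, forall x, F x (s x),
        forall y, (exists x, s x = y) <-> ~ Dn n y &
        forall x, s x = x \/
          exists z k l, [/\ Kn n k z, Kn n l z, 0 < l, x = e k z & s x = e l z]].
  apply: (shift_exists genF meq).
  - move=> k; apply: bset_and => //; bset_connectives => //.
  - move=> [|k]; first exact: bfun_id.
    by apply: bfun_comp => //; apply: bfun_iter.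
  - by move=> x; split=> [Dx|[]//]; split=> //; left.
  - by move=> k x [].
  - move=> x Dx j; have [_ [/(_ j)[k [jk kE]] _]] := Dx.
    by exists k; split=> //; split=> //; right.
  - by [].
  - move=> [|k] x _ //=; apply: F_trans (iterF k.+1 x) (tr_rel trB _).
  - move=> k x l y Kx Ky exy; have [[Lx _] kx] := Kx; have [[Ly _] ky] := Ky.
    case: k => [|k] in Kx kx exy *; case: l => [|l] in Ky ky exy *.
    + by split.
    + by case: (iterL l y Ly); rewrite -/(e l.+1 y) -exy.
    + by case: (iterL k x Lx); rewrite -/(e k.+1 x) exy.
    (* Equal values of [piB] together with the common coordinate [n] force the two iterates to be
       equal. *)
    + case: kx => // kx; case: ky => // ky.
      by apply: (iter_inj fI fnL) => //; apply: kapI => //; rewrite kx ky.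
have sB n x : B (s n x) <-> B x.
  have [_ _ _ _ /(_ x)[->//|[z [k [l [Kk Kl l0 xE sxE]]]]]] := sP n.
  by rewrite xE -xE sxE xE; split=> _; [apply: Be Kk|apply: Be Kl].
have s_fix n x : left_over x -> ~ Dn n x -> s n x = x.
  move=> Lx nDx; have [_ _ _ _ /(_ x)[//|[z [k [l [Kk _ _ xE _]]]]]] := sP n.
  have k0 : k = 0 by apply: e_left Kk _; rewrite -xE.
  by case: nDx; rewrite xE k0; case: Kk.
(* The shifts are composed one coordinate at a time. Each fixes the left-over points outside its own
   [Dn n], so what earlier shifts removed from the image stays removed. *)
have step j : exists s' : X -> X,
    [/\ bfun s', injective s', forall x, F x (s' x) &
      forall y, (exists x, B x /\ s' x = y) <->
        B y /\ ~ exists n, n < j /\ Dn n y].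
  elim: j => [|j [s' [ms' s'I s'F s'P]]].
    exists id; split=> [|//|x|y]; [exact: bfun_id|exact: F_refl|].
    split=> [[x [Bx <-]]|[By _]]; last by exists y.
    by split=> // -[n []].
  have [ms sI sF sR _] := sP j.
  exists (fun x => s j (s' x)); split=> [||x|y].
  - exact: bfun_comp.
  - exact: inj_comp sI s'I.
  - exact: F_trans (s'F x) (sF _).
  - split=> [[x [Bx sxy]]|[By nDy]].
      have [Bw nDw] : B (s' x) /\ ~ exists n, n < j /\ Dn n (s' x).
        by apply/s'P; exists x.
      split; first by rewrite -sxy; apply/sB.
      have nDj : ~ Dn j y by apply/sR; exists (s' x).
      move=> [n [nj Dny]]; have [njE|njN] := pselect (n = j); first by rewrite njE in Dny.
      have sy : s j y = y by apply: s_fix => //; case: Dny.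
      rewrite -sxy in sy; move/sI: sy => sy; rewrite -sy sxy in nDw.
      apply: nDw; exists n; split=> //; move: nj; rewrite ltnS leq_eqVlt.
      by case/orP => // /eqP.
    have [w sw] : exists w, s j w = y.
      by apply/sR => Dj; apply: nDy; exists j.
    have Bw : B w by apply/(sB j); rewrite sw.
    have [x [Bx s'x]] : exists x, B x /\ s' x = w.
      apply/s'P; split=> // -[n [nj Dw]].
      have nDjw : ~ Dn j w.
        by move=> /(Dn_fun _ _ _ Dw) njE; rewrite njE ltnn in nj.
      have sww : s j w = w by apply: s_fix => //; case: Dw.
      by apply: nDy; exists n; rewrite -sw sww ltnS ltnW.
    by exists x; rewrite s'x.
have [s' [ms' s'I s'F s'P]] := step m; exists s'; split=> // y.
split=> [/s'P[By nD]|[a Ha]]; last first.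
  apply/s'P; split; first exact: (pm_ran pmH Ha).
  move=> [n [_ [[_ nHy] _]]]; apply: nHy; exists a; split=> //.
  by apply: F_sym; apply: (pm_rel pmH Ha).
apply: contrapT => nHy; apply: nD.
have [n0 n0m inf0] := @infinite_pigeonhole m (fun k => kap (iter k f y)) (fun=> kapm _).
have ex0 : exists n, `[< inf n y >] by exists n0; apply/asboolP.
case: (ex_minnP ex0) => n /asboolP infn minn.
exists n; split.
  by apply: leq_ltn_trans n0m; apply: minn; apply/asboolP.
split; first by split=> // -[a [_ Ha]]; apply: nHy; exists a.
split=> // n' n'n /asboolP infn'; have := minn _ infn'.
by rewrite leqNgt n'n.
Qed.

End Absorption.

(** * Cancellation: matching two sets of selected points *)

Section TransversalUnique.
Context d (X : measurableType d) (E F : X -> X -> Prop) (g : nat -> X -> X).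
Hypothesis genE : generated E g.
Hypothesis genF : generated F g.
Hypothesis EF : forall x y, E x y -> F x y.
Hypothesis meq : brel (@eq X).

(** A Borel numbering of the points of each fibre of [pi], which therefore has at most [m]
    points. *)
Record coordinates (pi : X -> X) (m : nat) (kap : X -> nat) : Prop := Coordinates {
  co_bset : forall n, bset (fun x => kap x = n);
  co_lt : forall x, kap x < m;
  co_inj : forall x y, pi x = pi y -> kap x = kap y -> x = y
}.

(* Both [A] and [B] are an [m]-th part of the whole space: this is the
   cancellation law [m A = m B -> A = B] for equidecomposability. *)
Lemma transversal_matching (piA piB : X -> X) (m : nat) (kapA kapB : X -> nat) :
  transversal_map E F piA -> transversal_map E F piB ->
  (forall x, piA (piA x) = piA x) -> (forall x, piB (piB x) = piB x) ->
  coordinates piA m kapA -> coordinates piB m kapB ->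
  exists R, [/\ partial_matching F R (fun x => piA x = x) (fun x => piB x = x),
    forall x, piA x = x -> exists y, R x y &
    forall y, piB y = y -> exists x, R x y].
Proof.
move=> trA trB idA idB [mkA kAm kAI] [mkB kBm kBI].
have [F_sym F_trans] := (gen_sym genF, gen_trans genF).
have mA : bset (fun x => piA x = x).
  by apply: meq; [exact: tr_bfun trA|exact: bfun_id].
have mB : bset (fun x => piB x = x).
  by apply: meq; [exact: tr_bfun trB|exact: bfun_id].
have [H [pmH maxH]] := maximal_matching genF meq mA mB.
have [sB [msB sBI sBF sBP]] : exists s : X -> X,
    [/\ bfun s, injective s, forall x, F x (s x) &
      forall y, (exists x, piB x = x /\ s x = y) <-> exists a, H a y].
  apply: (absorption genE genF EF meq trA trB idA idB mkB kBm kBI pmH).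
  by move=> x y By nHy Ax xy; have [//|/nHy] := maxH x y Ax By xy.
have [sA [msA sAI sAF sAP]] : exists s : X -> X,
    [/\ bfun s, injective s, forall x, F x (s x) &
      forall y, (exists x, piA x = x /\ s x = y) <-> exists b, H y b].
  apply: (absorption genE genF EF meq trB trA idB idA mkA kAm kAI
    (partial_matching_sym genF pmH)).
  by move=> x y Ay nHy Bx /F_sym yx; have [/nHy|//] := maxH y x Ay Bx yx.
(* [sA] carries one set onto the domain of [H] and [sB] carries the other onto its range, so pulling
   [H] back along them leaves no point unmatched. *)
exists (fun x y => (piA x = x /\ piB y = y) /\ H (sA x) (sB y)); split.
- split.
  + move=> u v mu mv; have [mpA mpB] := (tr_bfun trA, tr_bfun trB).
    bset_connectives; [| |by apply: (pm_brel pmH); apply: bfun_comp].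
      by apply: meq => //; apply: bfun_comp.
    by apply: meq => //; apply: bfun_comp.
  + by move=> x y [[]].
  + by move=> x y [[]].
  + move=> x y [_ /(pm_rel pmH) xy].
    exact: F_trans (sAF x) (F_trans _ _ _ xy (F_sym _ _ (sBF y))).
  + by move=> x y y' [_ xy] [_ xy']; apply: sBI; apply: (pm_fun pmH xy xy').
  + by move=> x x' y [_ xy] [_ xy']; apply: sAI; apply: (pm_inj pmH xy xy').
- move=> x Ax; have [b Hb] : exists b, H (sA x) b by apply/sAP; exists x.
  have [y [By yb]] : exists y, piB y = y /\ sB y = b by apply/sBP; exists (sA x).
  by exists y; rewrite yb.
- move=> y By; have [a Ha] : exists a, H a (sB y) by apply/sBP; exists y.
  have [x [Ax xa]] : exists x, piA x = x /\ sA x = a by apply/sAP; exists (sB y).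
  by exists x; rewrite xa.
Qed.

End TransversalUnique.

(** * Countable separation of standard Borel spaces *)

Section StandardBorel.
Import Order.TTheory GRing.Theory Num.Theory.
Local Open Scope classical_set_scope.
Local Open Scope ring_scope.

Lemma standard_borel_separating d (X : measurableType d) :
  standard_borel X -> exists V : nat -> set X, separating V.
Proof.
move=> [R [T [f [hT [D /countable_injP[c cI] dD] [f' fK _] mX]]]].
pose U (i n : nat) : set T :=
  \bigcup_(a in [set a | D a /\ c a = i]) (ball a (n.+1%:R^-1 + n.+1%:R^-1 : R))°.
pose V k : set X := f @^-1` (let p := odflt (0%N, 0%N) (unpickle k) in U p.1 p.2).
exists V; split=> [k|x y xy].
  rewrite /bset; apply/mX; eexists; last by reflexivity.
  by apply: sub_sigma_algebra; apply: bigcup_open => a _; apply: open_interior.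
have fxy : f x != f y by apply/eqP => /(can_inj fK).
move: hT; rewrite ball_hausdorff => /(_ _ _ fxy)[[r s] /= /eqP rs].
(* The factor 3 allows one step [e] from [f x] to the dense point [a] and two from [a] to [f y]. *)
have [n nr] : exists n, 3 * (n.+1%:R^-1 : R) <= r%:num.
  have [n nr] := ltr_add_invr (divr_gt0 (gt0 r) (ltr0n R 3)); exists n.
  by rewrite add0r in nr; rewrite mulrC -ler_pdivlMr// ltW.
pose e : R := n.+1%:R^-1; have e0 : 0 < e by rewrite invr_gt0 ltr0n.
have [a [/= xa Da]] : (ball (f x) e)° `&` D !=set0.
  apply: dD; last exact: open_interior.
  by exists (f x); apply: nbhsx_ballx.
have {}xa : ball (f x) e a by apply: interior_subset.
exists (pickle (c a, n)); rewrite /V pickleK /=; split.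
  exists a => //; rewrite /interior /=.
  apply: (filterS _ (nbhsx_ballx (f x) _ e0)) => z xz.
  exact: ball_triangle (ball_sym xa) xz.
move=> [b [Db cb] /interior_subset yb].
have ab : b = a by apply: cI => //; apply/mem_set.
have : (ball (f x) r%:num `&` ball (f y) s%:num) (f y).
  split; last exact: ballxx.
  apply: (le_ball nr); rewrite -/e (_ : 3 * e = e + (e + e)); last by ring.
  by apply: (ball_triangle xa); rewrite -ab.
by rewrite rs.
Qed.

End StandardBorel.

(** * Countable groups of automorphisms and their orbits *)

Section CountableSubgroup.
Local Open Scope group_scope.
Context (G : groupType).

Record subgroup_seq (c : nat -> G) : Prop := SubgroupSeq {
  sg_one : exists i, c i = 1;
  sg_mul : forall i j, exists k, c k = c i * c j;
  sg_inv : forall i, exists k, c k = (c i)^-1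
}.

Let letter (t : nat -> G) (p : bool * nat) := if p.1 then t p.2 else (t p.2)^-1.
Let word t s := foldr (fun p x => letter t p * x) 1 s.

(** Words in the [t i] and their inverses are lists over a countable type. Concatenation gives
    products; reversing a word and flipping its signs gives inverses. *)
Lemma generated_subgroup_seq (t : nat -> G) :
  exists2 c, subgroup_seq c & forall i, exists k, c k = t i.
Proof.
have word_cat s s' : word t (s ++ s') = word t s * word t s'.
  by elim: s => [|p s IH] /=; rewrite ?mul1g// IH mulgA.
have word1 p : word t [:: p] = letter t p by rewrite /= mulg1.
pose decode k : seq (bool * nat) := odflt [::] (unpickle k).
pose c k := word t (decode k).
have cE s : c (pickle s) = word t s by rewrite /c /decode pickleK.
exists c; last by move=> i; exists (pickle [:: (true, i)]); rewrite cE word1.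
split=> [|i j|i]; first by exists (pickle ([::] : seq (bool * nat))); rewrite cE.
  exists (pickle (decode i ++ decode j)).
  by rewrite cE word_cat.
suff inv s : exists k, c k = (word t s)^-1 by apply: inv.
elim: s => [|p s [k kE]].
  by exists (pickle ([::] : seq (bool * nat))); rewrite cE /= invg1.
exists (pickle (decode k ++ [:: (~~ p.1, p.2)])).
rewrite cE word_cat word1 [word t (p :: s)]/= invgM -kE; congr (_ * _).
by rewrite /letter; case: (p.1); rewrite /= ?invgK.
Qed.

End CountableSubgroup.

Section OrbitRelation.
Local Open Scope group_scope.
Context d (X : measurableType d) (E : cber X).
Hypothesis meq : brel (@eq X).

Definition seq_orbit (c : nat -> aut E) (x y : X) := exists i, y = c i x.

Lemma aut_inj (S : aut E) : injective S.
Proof. exact: can_inj (aut_funK S). Qed.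

Lemma autM (S T : aut E) x : (S * T) x = S (T x). Proof. by []. Qed.

Lemma autKV (S : aut E) x : S (S^-1 x) = x. Proof. exact: aut_invK. Qed.

Lemma autVK (S : aut E) x : S^-1 (S x) = x. Proof. exact: aut_funK. Qed.

(** Intersecting [Q] with the orbits lets the automorphisms [c i] themselves serve as covering
    maps. *)
Lemma generated_orbit (c : nat -> aut E) (Q : X -> X -> Prop) :
  subgroup_seq c -> brel Q -> (forall x, Q x x) ->
  (forall x y, Q x y -> Q y x) -> (forall x y z, Q x y -> Q y z -> Q x z) ->
  generated (fun x y => Q x y /\ seq_orbit c x y) c.
Proof.
move=> [[i1 c1] cM cV] mQ Qxx Qsym Qtrans; split.
- by move=> x; split=> //; exists i1; rewrite c1.
- move=> x y [xy [i yE]]; split; first exact: Qsym.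
  by have [j cj] := cV i; exists j; rewrite cj yE autVK.
- move=> x y z [xy [i yE]] [yz [j zE]]; split; first exact: Qtrans xy yz.
  by have [k ck] := cM j i; exists k; rewrite ck autM -yE.
- move=> u v mu mv; apply: bset_and; first exact: mQ.
  apply: bset_ex => i; apply: meq => //.
  exact: (bfun_comp (aut_measurable (c i)) mu).
- by move=> i; apply: aut_measurable.
- by move=> i; apply: aut_inj.
- by move=> x y [_ [i ->]]; exists i.
Qed.

Lemma seq_orbit_equiv (c : nat -> aut E) : subgroup_seq c ->
  [/\ forall x, seq_orbit c x x, forall x y, seq_orbit c x y -> seq_orbit c y x &
      forall x y z, seq_orbit c x y -> seq_orbit c y z -> seq_orbit c x z].
Proof.
move=> hc; have gen : generated (fun x y => True /\ seq_orbit c x y) c.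
  by apply: generated_orbit => // u v mu mv; exact: bset_const.
split=> [x|x y xy|x y z xy yz].
- by have [] := gen_refl gen x.
- by have [] := gen_sym gen (conj I xy).
- by have [] := gen_trans gen (conj I xy) (conj I yz).
Qed.

Lemma brel_cber : brel E.
Proof. by move=> u v mu mv; exact: (bset_rel (cber_measurable E) mu mv). Qed.

Lemma aut_bfun (S : aut E) : bfun S. Proof. exact: aut_measurable. Qed.

End OrbitRelation.

(** * Outer actions through representatives *)

Section OuterRepresentatives.
Local Open Scope group_scope.
Context d (X : measurableType d) (E : cber X).

Lemma out_mapP (S T : aut E) : out_map E S = out_map E T <-> forall x, E (S x) (T x).
Proof.
split=> [/quot_mapP h x|h].
  have hx : E ((S^-1 * T) x) x by exact: h.
  move: hx; rewrite autM => /(aut_rel S); rewrite autKV.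
  exact: cber_sym.
apply/quot_mapP; suff : inn_set (S^-1 * T) by [].
by move=> x; apply/(aut_rel S); rewrite autM autKV; apply: cber_sym.
Qed.

(** The trace on representatives of being a homomorphism into [out E]. *)
Definition outer_rep (K : groupType) (T : K -> aut E) :=
  forall k l x, E (T (k * l) x) (T k (T l x)).

Lemma outer_rep_exists (K : groupType) (phi : {ghom K -> out E}) :
  exists T : K -> aut E, outer_rep T /\ forall k, out_map E (T k) = phi k.
Proof.
have /choice[T TE] k : exists S : aut E, out_map E S = phi k.
  by have [S ->] := quot_map_surj (phi k); exists S.
exists T; split=> // k l x.
have h : out_map E (T (k * l)) = out_map E (T k * T l).
  by rewrite gmulfM !TE gmulfM.
exact: (out_mapP _ _).1 h x.
Qed.

Lemma outer_rep1 (K : groupType) (T : K -> aut E) : outer_rep T ->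
  forall x, E (T 1 x) x.
Proof.
move=> hT x; apply: cber_sym; apply/(aut_rel (T 1)).
by have := hT 1 1 x; rewrite mulg1.
Qed.

(** The inverse of [s k] is [s k^-1], and [s k] preserves [E] because it agrees up to [E] with the
    automorphism [T k]. *)
Lemma ghom_of_action (K : groupType) (T : K -> aut E) (s : K -> X -> X) :
  (forall k, bfun (s k)) -> (forall x, s 1 x = x) ->
  (forall k l x, s (k * l) x = s k (s l x)) ->
  (forall k x, E (s k x) (T k x)) ->
  exists psi : {ghom K -> aut E}, forall k x, psi k x = s k x.
Proof.
move=> ms s1 sM sT.
have sK k : cancel (s k) (s k^-1) by move=> x; rewrite -sM mulVg s1.
have sVK k : cancel (s k^-1) (s k) by move=> x; rewrite -sM mulgV s1.
have sE k x y : E x y <-> E (s k x) (s k y).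
  rewrite (aut_rel (T k)); split=> h.
    exact: cber_trans (sT k x) (cber_trans h (cber_sym (sT k y))).
  exact: cber_trans (cber_sym (sT k x)) (cber_trans h (sT k y)).
pose f k := Aut (sK k) (sVK k) (ms k) (ms k^-1) (sE k).
have f1 : f 1 = 1 by apply: aut_ext => x /=.
have fM : {morph f : x y / x * y} by move=> k l; apply: aut_ext => x /=.
pose hf := isUMagmaMorphism.Build K (aut E) f (f1, fM).
pose psi : {ghom K -> aut E} := HB.pack f hf.
by exists psi.
Qed.

End OuterRepresentatives.

(** * Lifting outer actions of finite groups *)

Section FiniteExtension.
Local Open Scope group_scope.
Context d (X : measurableType d) (E : cber X) (L : groupType) (T : L -> aut E).
Hypothesis repT : outer_rep T.
Context (m : nat) (e : 'I_m -> L).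
Hypothesis e_surj : forall n, exists i, e i = n.

(** The equivalence relation generated by [E] and the maps [T n]; one step suffices because the
    representatives multiply up to [E]. *)
Definition extension (x y : X) := exists n, E (T n x) y.

Lemma extension_sub x y : E x y -> extension x y.
Proof. by exists 1; apply: cber_trans (outer_rep1 repT x) _. Qed.

Lemma extension_refl x : extension x x.
Proof. exact: extension_sub (cber_refl E x). Qed.

Lemma extension_sym x y : extension x y -> extension y x.
Proof.
move=> [n xy]; exists n^-1.
have := (aut_rel (T n^-1) _ _).1 (cber_sym xy) => /cber_trans; apply.
apply: cber_trans (cber_sym (repT _ _ _)) _; rewrite mulVg; exact: outer_rep1.
Qed.

Lemma extension_trans x y z : extension x y -> extension y z -> extension x z.
Proof.
move=> [n xy] [k yz]; exists (k * n); apply: cber_trans (repT _ _ _) _.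
exact: cber_trans ((aut_rel (T k) _ _).1 xy) yz.
Qed.

Lemma extensionE x n : extension x (T n x).
Proof. by exists n; apply: cber_refl. Qed.

Lemma extension_brel : brel extension.
Proof.
move=> u v mu mv; apply: (bset_ext (Q := fun x => exists i, E (T (e i) (u x)) (v x))).
  move=> x; split=> [[n xy]|[i xy]]; last by exists (e i).
  by have [i iE] := e_surj n; exists i; rewrite iE.
apply: bset_ex => i; apply: brel_cber => //.
exact: (bfun_comp (aut_bfun (T (e i))) mu).
Qed.

End FiniteExtension.

(* Restricting [E] to the orbits of a countable group containing the chosen
   representatives makes it [generated] by that group. *)
Lemma finite_outer_lift d (X : measurableType d) (E : cber X) (V : nat -> set X)
    (L : groupType) (T : L -> aut E) (m : nat) (e : 'I_m -> L) :
  separating V -> outer_rep T -> (forall n, exists i, e i = n) ->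
  exists alpha : {ghom L -> aut E},
    class_bijective alpha /\ forall n x, E (alpha n x) (T n x).
Proof.
Local Open Scope group_scope.
move=> sepV repT e_surj; have meq := brel_eq sepV.
(* The finite list of representatives, padded with the identity. *)
pose t k : aut E := if insub k is Some i then T (e i) else 1.
have [c hc ct] := generated_subgroup_seq t.
have cT n : exists k, c k = T n.
  have [i <-] := e_surj n; have [k kE] := ct i; exists k.
  by rewrite kE /t valK.
have [c_refl c_sym c_trans] := seq_orbit_equiv meq hc.
have oT n x : seq_orbit c x (T n x) by have [k <-] := cT n; exists k.
pose E0 x y := E x y /\ seq_orbit c x y.
pose F0 x y := extension T x y /\ seq_orbit c x y.
have genE : generated E0 c.
  apply: generated_orbit => //; [exact: brel_cber|exact: cber_refl| |].
    by move=> x y; apply: cber_sym.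
  by move=> x y z; apply: cber_trans.
have genF : generated F0 c.
  apply: generated_orbit => //.
  - exact: extension_brel e_surj.
  - exact: extension_refl.
  - exact: extension_sym.
  - exact: extension_trans.
have EF x y : E0 x y -> F0 x y.
  by move=> [xy oxy]; split=> //; apply: extension_sub.
have TE n x y : E0 x y -> E0 (T n x) (T n y).
  move=> [xy oxy]; split; first exact: (aut_rel (T n) _ _).1 xy.
  exact: c_trans (c_sym _ _ (oT n x)) (c_trans _ _ _ oxy (oT n y)).
have TF n x : F0 x (T n x) by split; [exact: extensionE|exact: oT].
have FT x y : F0 x y -> exists i, E0 (T (e i) x) y.
  move=> [[n xy] oxy]; have [i iE] := e_surj n; exists i; rewrite iE; split=> //.
  exact: c_trans (c_sym _ _ (oT n x)) oxy.
have [pi trpi] : exists pi, transversal_map E0 F0 pi.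
  apply: (transversal_map_exists genE genF EF sepV (T := fun i => T (e i))).
  - by move=> i; apply: aut_bfun.
  - by move=> i; apply: aut_inj.
  - by move=> i x y; apply: TE.
  - by move=> i x; apply: TF.
  - exact: FT.
have mpi := tr_bfun trpi.
(* The lift moves [x] within its fibre of [pi], to the only point there in the [E0]-class of
   [T n x]. *)
pose R n x z := E0 z (T n x) /\ pi z = pi x.
have Rfun n x z z' : R n x z -> R n x z' -> z = z'.
  move=> [zx pz] [zx' pz']; apply: (tr_inj trpi); last by rewrite pz pz'.
  exact: (gen_trans genE zx (gen_sym genE zx')).
have /choice[s sP] n : exists s : X -> X, bfun s /\ forall x, R n x (s x).
  have [s ms sR] : exists2 s, bfun s & forall x z, s x = z <-> R n x z.
    apply: (measurable_graph genF (R := R n)).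
    - move=> u v mu mv; apply: bset_and.
        by apply: (gen_brel genE) => //; exact: (bfun_comp (aut_bfun (T n)) mu).
      by apply: meq; apply: bfun_comp.
    - move=> x; have [z [zx zp]] := tr_surj trpi (gen_sym genF (TF n x)).
      by exists z.
    - move=> x z [/EF zx _]; exact: (gen_trans genF (TF n x) (gen_sym genF zx)).
    - exact: Rfun.
  by exists s; split=> // x; apply/sR.
have s1 x : s 1 x = x.
  apply: (Rfun 1 x); first by case: (sP 1).
  split=> //; split; last exact: oT.
  exact: cber_sym (outer_rep1 repT x).
have sM k l x : s (k * l) x = s k (s l x).
  apply: (Rfun (k * l) x); first by case: (sP (k * l)).
  have [E1 p1] := (sP k).2 (s l x); have [E2 p2] := (sP l).2 x.
  split; last by rewrite p1.
  apply: (gen_trans genE E1); apply: (gen_trans genE (TE k _ _ E2)).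
  split; first exact/cber_sym/repT.
  apply: (c_trans _ x); last exact: oT.
  by apply: c_sym; exact: (c_trans _ _ _ (oT l x) (oT k _)).
have sT n x : E (s n x) (T n x) by have [[]] := (sP n).2 x.
have [alpha alphaE] := ghom_of_action (fun n => (sP n).1) s1 sM sT.
exists alpha; split=> [n x|n x]; rewrite alphaE //.
(* Class-bijectivity: a point and its image share a fibre of [pi], and a fibre meets each class at
   most once. *)
move=> sx; have [[_ os] ps] := (sP n).2 x.
apply: (tr_inj trpi) => //; split=> //.
exact: (c_trans _ _ _ os (c_sym _ _ (oT n x))).
Qed.

(** * Selecting a point in each orbit of a finite group, and the maps induced on selected points *)

Section FiniteAction.
Local Open Scope group_scope.
Context d (X : measurableType d) (E : cber X) (V : nat -> set X).
Hypothesis sepV : separating V.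
Context (L : groupType) (alpha : {ghom L -> aut E}).
Context (m : nat) (e : 'I_m -> L).
Hypothesis e_surj : forall n, exists i, e i = n.

Let meq : brel (@eq X) := brel_eq sepV.

Lemma actM k l x : alpha (k * l) x = alpha k (alpha l x).
Proof. by rewrite gmulfM. Qed.

Lemma act1 x : alpha 1 x = x.
Proof. by rewrite gmulf1. Qed.

Lemma actK k x : alpha k^-1 (alpha k x) = x.
Proof. by rewrite -actM mulVg act1. Qed.

Record orbit_selector (pi : X -> X) : Prop := OrbitSelector {
  os_bfun : bfun pi;
  os_act : forall x, exists n, pi x = alpha n x;
  os_inv : forall n x, pi (alpha n x) = pi x
}.

(* The sets [nbh k] are the finite intersections of the [V j]. The selected
   point of an orbit is the one isolated in it by the first [nbh k] that
   isolates a point of the orbit. *)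
Lemma orbit_selector_exists : exists pi, orbit_selector pi.
Proof.
pose nbh k x := forall j : nat, j \in odflt [::] (unpickle k : option (seq nat)) -> V j x.
pose iso k x := nbh k x /\ forall i : 'I_m, alpha (e i) x = x \/ ~ nbh k (alpha (e i) x).
pose hit k x := exists i : 'I_m, iso k (alpha (e i) x).
pose Y x := exists k, iso k x /\ forall j, j < k -> ~ hit j x.
have mact n : bfun (alpha n) by apply: aut_bfun.
have mnbh k : bset (nbh k).
  by rewrite /nbh; bset_connectives; have [mV _] := sepV; exact: mV.
have miso k : bset (iso k).
  rewrite /iso; apply: bset_and => //; bset_connectives.
    by apply: meq => //; exact: bfun_id.
  exact: (bset_comp (mnbh k) (mact _)).
have mhit k : bset (hit k).
  by apply: bset_ex => i; exact: (bset_comp (miso k) (mact _)).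
have mY : bset Y.
  apply: bset_ex => k; apply: bset_and => //; apply: bset_all => j.
  by apply: bset_imp; [exact: bset_const|exact: bset_not].
have hitP k x : hit k x <-> exists n, iso k (alpha n x).
  split=> [[i]|[n]]; first by exists (e i).
  by have [i <-] := e_surj n; exists i.
have hit_act k n x : hit k (alpha n x) -> hit k x.
  by move=> /hitP[l]; rewrite -actM => ?; apply/hitP; exists (l * n).
have hitx k x : iso k x -> hit k x.
  by move=> ?; apply/hitP; exists 1; rewrite act1.
have Yuniq n x : Y x -> Y (alpha n x) -> alpha n x = x.
  move=> [k [ik lt_k]] [l [il lt_l]].
  have kl : k = l.
    case: (ltngtP k l) => // lt.
      by case: (lt_l _ lt); apply: (hit_act k n^-1); rewrite actK; apply: hitx.
    by case: (lt_k _ lt); apply: (hit_act l n); apply: hitx.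
  rewrite -kl in il; have [_ ik'] := ik; have [i iE] := e_surj n.
  by have [] := ik' i; rewrite iE //; case: il.
have Yex x : exists n, Y (alpha n x).
  have [k0 ik0] : exists k, iso k x.
    have /choice[c cP] i : exists k, alpha (e i) x <> x -> V k x /\ ~ V k (alpha (e i) x).
      have [->|ne] := pselect (alpha (e i) x = x); first by exists 0.
      have [k kP] := sepV.2 _ _ (fun h => ne (esym h)); by exists k.
    (* One separating set for each [e i] that moves [x]; their intersection isolates [x] in its
       orbit. *)
    pose s := [seq c i | i <- enum 'I_m & `[< alpha (e i) x <> x >]].
    exists (pickle s); rewrite /iso /nbh pickleK; split=> [j|i].
      by move=> /mapP[i]; rewrite mem_filter => /andP[/asboolP ne _] ->; case: (cP i ne).
    have [|ne] := pselect (alpha (e i) x = x); first by left.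
    right=> /(_ (c i)) h; case: (cP i ne) => _; apply; apply: h.
    by apply/mapP; exists i => //; rewrite mem_filter mem_enum andbT; apply/asboolP.
  have ex0 : exists k, `[< hit k x >] by exists k0; apply/asboolP; apply: hitx.
  case: (ex_minnP ex0) => k /asboolP[i ik] mink.
  exists (e i), k; split=> // j jk /hit_act/asboolP /mink.
  by rewrite leqNgt jk.
have [pi mpi piP] : exists2 pi : X -> X, bfun pi & forall x y,
    pi x = y <-> (Y y /\ exists i, y = alpha (e i) x).
  apply: (measurable_graph_cover (h := fun i => alpha (e i))) => //.
  - move=> i; apply: bset_and; first exact: (bset_comp mY (mact _)).
    by apply: bset_ex => j; apply: meq.
  - move=> x; have [n Yn] := Yex x; have [i iE] := e_surj n.
    by exists (alpha n x); split=> //; exists i; rewrite iE.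
  - by move=> x y [_ [i ->]]; exists i.
  - move=> x y y' [Yy [i yE]] [Yy' [j y'E]].
    have y'y : y' = alpha (e j * (e i)^-1) y by rewrite yE actM actK.
    by rewrite y'y in Yy' *; rewrite Yuniq.
exists pi; split=> // [x|n x].
  by have [_ [i ->]] := (piP x (pi x)).1 erefl; exists (e i).
apply/piP; have [Yp [i piE]] := (piP x (pi x)).1 erefl; split=> //.
have [j jE] := e_surj (e i * n^-1).
by exists j; rewrite jE actM actK.
Qed.

Section Selected.
Context (pi : X -> X).
Hypothesis pi_sel : orbit_selector pi.
Hypothesis cb : class_bijective alpha.

Lemma os_idem x : pi (pi x) = pi x.
Proof. by have [n {1}->] := os_act pi_sel x; rewrite (os_inv pi_sel). Qed.

Lemma os_orbit x y : pi x = pi y -> exists n, y = alpha n x.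
Proof.
have [k ->] := os_act pi_sel x; have [l ->] := os_act pi_sel y => xy.
by exists (l^-1 * k); rewrite actM xy actK.
Qed.

Lemma os_inj x y : E x y -> pi x = pi y -> x = y.
Proof. by move=> xy /os_orbit[n yE]; rewrite yE cb// -yE; apply: cber_sym. Qed.

(** Number [x] by the least [i] such that [alpha (e i)] carries the selected point to [x]. Several
    indices may do so, since points can have stabilizers and [e] can repeat. *)
Lemma os_coordinates : exists kap, coordinates pi m kap.
Proof.
pose K x (i : 'I_m) := alpha (e i) (pi x) = x /\
  forall j : 'I_m, j < i -> alpha (e j) (pi x) <> x.
have /choice[kap kapP] x : exists i, K x i.
  have [n pE] := os_act pi_sel x; have [i0 i0E] := e_surj n^-1.
  pose p i := `[< alpha (e i) (pi x) = x >].
  have p0 : p i0 by apply/asboolP; rewrite i0E pE actK.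
  case: (arg_minnP (fun n : 'I_m => val n) p0) => i /asboolP ix mini.
  exists i; split=> // j ji /asboolP jx; have := mini j jx.
  by rewrite leqNgt ji.
have Kfun x i j : K x i -> K x j -> i = j.
  move=> [ix lti] [jx ltj]; apply/val_inj; case: (ltngtP i j) => // lt.
    by case: (ltj _ lt).
  by case: (lti _ lt).
exists (fun x => val (kap x)); split=> [n|x|x y pxy /val_inj kxy].
- apply: (bset_ext (Q := fun x => exists i : 'I_m, val i = n /\ K x i)).
    move=> x; split=> [kn|[i [<- Ki]]]; first by exists (kap x).
    by rewrite (Kfun _ _ _ Ki (kapP x)).
  have mpi := os_bfun pi_sel.
  have mapi i : bfun (fun x => alpha (e i) (pi x)).
    by apply: bfun_comp => //; apply: aut_bfun.
  by rewrite /K; bset_connectives; apply: meq => //; exact: bfun_id.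
- exact: ltn_ord.
- by have [<- _] := kapP x; have [<- _] := kapP y; rewrite kxy pxy.
Qed.

Variable (T : aut E).
Hypothesis normT : forall n, exists n', forall x, E (T (alpha n x)) (alpha n' (T x)).
Hypothesis normT' : forall n, exists n', forall x, E (alpha n (T x)) (T (alpha n' x)).

Let rep_alpha : outer_rep alpha.
Proof. by move=> k l x; rewrite actM; apply: cber_refl. Qed.

Lemma extension_norm x y : extension alpha x y -> extension alpha (T x) (T y).
Proof.
move=> [n xy]; have [n' h] := normT n; exists n'.
exact: cber_trans (cber_sym (h x)) ((aut_rel T _ _).1 xy).
Qed.

Lemma extension_normV x y : extension alpha (T x) (T y) -> extension alpha x y.
Proof.
move=> [n xy]; have [n' h] := normT' n; exists n'; apply/(aut_rel T).
exact: cber_trans (cber_sym (h x)) xy.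
Qed.

(* [theta] makes [T] act on the space of orbits, identified with the set of
   fixed points of the selector. *)
Lemma induced_on_selection : exists theta theta' : X -> X,
  [/\ bfun theta /\ bfun theta', cancel theta theta' /\ cancel theta' theta,
    forall x, pi x = x -> pi (theta x) = theta x /\ extension alpha (theta x) (T x) &
    forall x, pi x <> x -> theta x = x].
Proof.
(* The default value is [T], so the index [m] puts [T] among the generators. *)
pose t k : aut E := if insub k is Some i then alpha (e i) else T.
have [c hc ct] := generated_subgroup_seq t.
have cA n : exists k, c k = alpha n.
  have [i <-] := e_surj n; have [k kE] := ct i; exists k.
  by rewrite kE /t valK.
have cT : exists k, c k = T.
  by have [k kE] := ct m; exists k; rewrite kE /t insubF ?ltnn.
have cTV : exists k, c k = T^-1.
  by have [k <-] := cT; apply: sg_inv hc k.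
have [c_refl c_sym c_trans] := seq_orbit_equiv meq hc.
have cAx n x : seq_orbit c x (alpha n x) by have [k <-] := cA n; exists k.
have cTx x : seq_orbit c x (T x) by have [k <-] := cT; exists k.
have cTVx x : seq_orbit c x (T^-1 x) by have [k <-] := cTV; exists k.
pose F := extension alpha.
pose E0 x y := E x y /\ seq_orbit c x y.
pose F0 x y := F x y /\ seq_orbit c x y.
have genE : generated E0 c.
  apply: generated_orbit => //; [exact: brel_cber|exact: cber_refl| |].
    by move=> x y; apply: cber_sym.
  by move=> x y z; apply: cber_trans.
have genF : generated F0 c.
  apply: generated_orbit => //.
  - exact: extension_brel e_surj.
  - exact: extension_refl.
  - exact: extension_sym.
  - exact: extension_trans.
have genO : generated (fun x y => True /\ seq_orbit c x y) c.
  by apply: generated_orbit => // u v mu mv; exact: bset_const.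
have EF x y : E0 x y -> F0 x y.
  by move=> [xy oxy]; split=> //; apply: extension_sub.
have conj_orbit (S : aut E) x y : (forall z, seq_orbit c z (S z)) ->
    seq_orbit c x y -> seq_orbit c (S x) (S y).
  move=> cS xy; apply: (c_trans _ x); first exact: c_sym.
  exact: c_trans _ _ _ xy (cS y).
have FT x y : F0 x y -> F0 (T x) (T y).
  by move=> [xy oxy]; split; [exact: extension_norm|exact: conj_orbit].
have FTV x y : F0 x y -> F0 (T^-1 x) (T^-1 y).
  move=> [xy oxy]; split; last exact: conj_orbit.
  by apply: extension_normV; rewrite !autKV.
have ET x y : E0 x y -> E0 (T x) (T y).
  by move=> [xy oxy]; split; [exact: (aut_rel T _ _).1|exact: conj_orbit].
have ETV x y : E0 x y -> E0 (T^-1 x) (T^-1 y).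
  move=> [xy oxy]; split; last exact: conj_orbit.
  by apply/(aut_rel T); rewrite !autKV.
have mpi := os_bfun pi_sel.
have trA : transversal_map E0 F0 pi.
  split=> //.
  - move=> x; have [n ->] := os_act pi_sel x; split; first exact: extensionE.
    exact: cAx.
  - by move=> x y [xy _]; apply: os_inj.
  - move=> x y [[n xy] oxy]; exists (alpha n^-1 y); split; last exact: os_inv.
    split; last by apply: c_trans (c_sym _ _ (cAx n^-1 y)) (c_sym _ _ oxy).
    by rewrite -[x in E _ x](actK n); apply/(aut_rel _ _ _).1/cber_sym.
(* The selector conjugated by [T]: its fixed points are the images under [T] of the selected
   points. *)
pose piB x := T (pi (T^-1 x)).
have mT : bfun T by apply: aut_bfun.
have mTV : bfun (T^-1)%g by apply: aut_bfun.
have trB : transversal_map E0 F0 piB.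
  split.
  - by apply: bfun_comp => //; apply: bfun_comp.
  - move=> x; rewrite -[x in F0 x _](autKV T); apply: FT; exact: (tr_rel trA).
  - move=> x y xy /aut_inj pxy; rewrite -(autKV T x) -(autKV T y).
    by congr (T _); apply: (tr_inj trA) => //; apply: ETV.
  - move=> x y /FTV /(tr_surj trA)[z [zx pz]]; exists (T z); split.
      by rewrite -(autKV T x); apply: ET.
    by rewrite /piB autVK pz.
have [kap coA] := os_coordinates.
have coB : coordinates piB m (fun x => kap (T^-1 x)).
  case: coA => mkap ltkap kapI; split=> [n|x|x y /aut_inj pxy kxy] //.
    exact: (bset_comp (mkap n) mTV).
  by rewrite -(autKV T x) -(autKV T y); congr (T _); apply: kapI.
have [R [pmR totR surR]] : exists R,
    [/\ partial_matching F0 R (fun x => pi x = x) (fun x => piB x = x),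
        forall x, pi x = x -> exists y, R x y &
        forall y, piB y = y -> exists x, R x y].
  apply: (transversal_matching genE genF EF meq trA trB _ _ coA coB).
    exact: os_idem.
  by move=> x; rewrite /piB autVK os_idem.
have piBT x : piB (T x) = T x <-> pi x = x.
  by rewrite /piB autVK; split=> [/aut_inj//|->].
have mpiY : bset (fun x => pi x = x) by apply: meq => //; exact: bfun_id.
(* A selected point goes to [T x] and then back along the matching to a selected point; every other
   point stays fixed. *)
pose Th x y := (pi x = x /\ R y (T x)) \/ (pi x <> x /\ y = x).
have mTh : brel Th.
  move=> u v mu mv; rewrite /Th; bset_connectives.
  - exact: (bset_comp mpiY mu).
  - by apply: (pm_brel pmR) => //; apply: bfun_comp.
  - exact: (bset_comp mpiY mu).
  - exact: meq.
have Th_orbit x y : Th x y -> seq_orbit c x y.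
  move=> [[_ Ry]|[_ ->]]; last exact: c_refl.
  have [_ oy] := pm_rel pmR Ry; exact: c_trans _ _ _ (cTx x) (c_sym _ _ oy).
have Th_fix x y : Th x y -> (pi x = x <-> pi y = y).
  by move=> [[px Ry]|[px ->]] //; have := pm_dom pmR Ry.
have [theta mth thP] : exists2 s : X -> X, bfun s & forall x y, s x = y <-> Th x y.
  apply: (measurable_graph genO) => //.
  - move=> x; have [px|px] := pselect (pi x = x); last by exists x; right.
    by have [y Ry] := surR (T x) ((piBT x).2 px); exists y; left.
  - by move=> x y /Th_orbit.
  - move=> x y y' [[px Ry]|[px ->]] [[px' Ry']|[px' ->]] //.
    exact: (pm_inj pmR Ry Ry').
have [theta' mth' thP'] : exists2 s : X -> X, bfun s & forall y x, s y = x <-> Th x y.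
  apply: (measurable_graph genO (R := fun y x => Th x y)).
  - by move=> u v mu mv; apply: mTh.
  - move=> y; have [py|py] := pselect (pi y = y); last by exists y; right.
    have [z Rz] := totR y py; exists (T^-1 z); left; rewrite autKV; split=> //.
    by apply/piBT; rewrite autKV; apply: (pm_ran pmR Rz).
  - by move=> y x /Th_orbit/c_sym.
  - move=> y x x' hx hx'; case: (hx) => [[px Ry]|[px yx]].
      case: (hx') => [[px' Ry']|[px' yx']].
        exact: aut_inj (pm_fun pmR Ry Ry').
      by case: px'; apply/(Th_fix _ _ hx')/(Th_fix _ _ hx).
    case: (hx') => [[px' Ry']|[px' yx']]; last by rewrite -yx -yx'.
    by case: px; apply/(Th_fix _ _ hx)/(Th_fix _ _ hx').
exists theta, theta'; split=> //.
- by split=> x; [apply/thP'/thP|apply/thP/thP'].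
- move=> x px; have [[_ Rx]|[]//] := (thP x (theta x)).1 erefl.
  by split; [exact: (pm_dom pmR Rx)|have [] := pm_rel pmR Rx].
- by move=> x px; have [[]//|[]] := (thP x (theta x)).1 erefl.
Qed.

End Selected.
End FiniteAction.

(** * The extended relation on the selected points, as a CBER on the whole space *)

Section SelectionRelation.
Local Open Scope classical_set_scope.
Local Open Scope group_scope.
Context d (X : measurableType d) (E : cber X) (V : nat -> set X).
Hypothesis sepV : separating V.
Context (L : groupType) (alpha : {ghom L -> aut E}) (m : nat) (e : 'I_m -> L).
Hypothesis e_surj : forall n, exists i, e i = n.
Context (pi : X -> X).
Hypothesis pi_sel : orbit_selector alpha pi.

Definition selection_rel x y :=
  x = y \/ ((pi x = x /\ pi y = y) /\ extension alpha x y).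

Lemma selection_cber : exists E2 : cber X, forall x y, E2 x y = selection_rel x y.
Proof.
have rep_alpha : outer_rep alpha.
  by move=> k l x; rewrite actM; apply: cber_refl.
have ext_sym := extension_sym rep_alpha.
have ext_trans := extension_trans rep_alpha.
have srefl x : selection_rel x x by left.
have ssym x y : selection_rel x y -> selection_rel y x.
  by move=> [->|[[px py] xy]]; [left|right; do !split=> //; apply: ext_sym].
have strans x y z : selection_rel x y -> selection_rel y z -> selection_rel x z.
  move=> [->//|[[px py] xy]] [<-|[[_ pz] yz]]; first by right.
  by right; do !split=> //; apply: ext_trans yz.
have smeas : measurable [set xy : X * X | selection_rel xy.1 xy.2].
  have mfix : bset (fun x => pi x = x).
    by apply: (bset_eq sepV); [exact: os_bfun pi_sel|exact: bfun_id].
  have m1 : measurable_fun setT (@fst X X) by exact: measurable_fst.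
  have m2 : measurable_fun setT (@snd X X) by exact: measurable_snd.
  suff : bset (fun xy : X * X => xy.1 = xy.2 \/
    ((pi xy.1 = xy.1 /\ pi xy.2 = xy.2) /\ extension alpha xy.1 xy.2)) by [].
  apply: bset_or; first exact: (bset_eq sepV).
  apply: bset_and.
    by apply: bset_and; [exact: (bset_comp mfix m1)|exact: (bset_comp mfix m2)].
  apply: (bset_ext (Q := fun xy => exists i, E (alpha (e i) xy.1) xy.2)).
    move=> xy; split=> [[n h]|[i h]]; last by exists (e i).
    by have [i iE] := e_surj n; exists i; rewrite iE.
  apply: bset_ex => i; apply: (bset_rel (cber_measurable E)) => //.
  exact: (measurableT_comp (aut_measurable (alpha (e i))) m1).
have scount x : countable [set y | selection_rel x y].
  apply: (@sub_countable _ _ _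
    (\bigcup_(i in [set: 'I_m]) [set y | E (alpha (e i) x) y])).
    apply: subset_card_le => y h.
    have [n xy] : extension alpha x y.
      by case: h => [<-|[_]//]; apply: extension_refl.
    by have [i iE] := e_surj n; exists i => //=; rewrite iE.
  by apply: bigcup_countable => // i _; apply: cber_countable.
by exists (Cber srefl ssym strans smeas scount).
Qed.

End SelectionRelation.

(** * From the finite normal subgroup and the quotient to the whole group *)

Section FiniteNormalSubgroup.
Local Open Scope group_scope.
Context (G : groupType) (N : normalSubgroup G).
Hypothesis finN : finite_set N.

Lemma subgroup_enum : exists m (e : 'I_m -> subgroup N), forall n, exists i, e i = n.
Proof.
have /finite_seqP[s sE] := finN.
exists (size s), (fun i => insubd 1 (nth 1 s i)) => n.
have ns : val n \in s.
  by have := set_mem (valP n); move: (val n) => g; rewrite sE.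
have ilt : (index (val n) s < size s)%N by rewrite index_mem.
by exists (Ordinal ilt); rewrite /= nth_index // valKd.
Qed.

Lemma subgroupP (g : G) : normal_set N g -> exists n : subgroup N, val n = g.
Proof. by move=> /mem_set Ng; exists (Sub g Ng); rewrite SubK. Qed.

Lemma subgroup_normal (n : subgroup N) : normal_set N (val n).
Proof. exact: set_mem (valP n). Qed.

Hypothesis liftH : outer_actions_lift (quotient_group N).

Lemma subgroup_lifting_property :
  class_bijective_lifting_property (subgroup_incl N).
Proof.
move=> d X stdX E alpha beta cb alphaE.
have [V sepV] := standard_borel_separating stdX.
have meq := brel_eq sepV.
have [m [e e_surj]] := subgroup_enum.
have [T [repT TE]] := outer_rep_exists beta.
have alphaT n x : E (alpha n x) (T (val n) x).
  apply: (out_mapP (alpha n) (T (val n))).1 => //.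
  by rewrite TE; have := alphaE n.
have T1 := outer_rep1 repT.
have TM g h x : E (T g (T h x)) (T (g * h) x) by apply/cber_sym/repT.
(* Normality of [N]: the element [n'] is [g * n * g^-1], and in the reverse direction
   [g^-1 * n * g]. *)
have normT g n : exists n', forall x, E (T g (alpha n x)) (alpha n' (T g x)).
  have [n' n'E] := subgroupP (normalJ g^-1 (subgroup_normal n)).
  exists n' => x; apply: cber_trans ((aut_rel (T g) _ _).1 (alphaT n x)) _.
  apply: cber_trans (TM _ _ _) _; apply: cber_trans _ (cber_sym (alphaT n' _)).
  apply: cber_trans _ (repT _ _ _); rewrite n'E /conjg invgK -!mulgA mulVg mulg1.
  exact: cber_refl.
have normT' g n : exists n', forall x, E (alpha n (T g x)) (T g (alpha n' x)).
  have [n' n'E] := subgroupP (normalJ g (subgroup_normal n)).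
  exists n' => x; apply: cber_trans _ ((aut_rel (T g) _ _).1 (cber_sym (alphaT n' x))).
  apply: cber_trans (alphaT n _) _; apply: cber_trans (TM _ _ _) _.
  apply: cber_trans _ (repT _ _ _); rewrite n'E /conjg mulVKg.
  exact: cber_refl.
pose F := extension alpha.
have rep_alpha : outer_rep alpha.
  by move=> k l x; rewrite actM; apply: cber_refl.
have F_sym : forall x y, F x y -> F y x := extension_sym rep_alpha.
have F_trans : forall x y z, F x y -> F y z -> F x z := extension_trans rep_alpha.
have EF : forall x y, E x y -> F x y := extension_sub rep_alpha.
have TF g x y : F x y -> F (T g x) (T g y) by exact: (extension_norm (normT g)).
(* Modulo [F] only the coset of [g] matters; this is what produces an outer action of the
   quotient. *)
have TN g h x : quot_map N g = quot_map N h -> F (T g x) (T h x).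
  move=> /quot_mapP/subgroupP[n nE].
  have -> : h = g * val n by rewrite nE mulVKg.
  apply: (F_trans _ _ _ _ (EF _ _ (TM g (val n) x))); apply: TF.
  by exists n; apply: alphaT.
have [pi pi_sel] := orbit_selector_exists sepV alpha e_surj.
have pi_idem := os_idem pi_sel.
have piF x : F x (pi x) by have [n ->] := os_act pi_sel x; apply: extensionE.
have /choice[theta thetaP] g : exists th : X -> X, exists th' : X -> X,
  [/\ bfun th /\ bfun th', cancel th th' /\ cancel th' th,
    forall x, pi x = x -> pi (th x) = th x /\ F (th x) (T g x) &
    forall x, pi x <> x -> th x = x].
  exact: (induced_on_selection sepV e_surj pi_sel cb (normT g) (normT' g)).
have [E2 E2E] := selection_cber sepV e_surj pi_sel.
have E2pi x y : pi x = x -> E2 x y -> pi y = y /\ F x y.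
  rewrite E2E => px [<-|[[_ py] xy]]; split=> //; exact: extension_refl.
have E2I x y : pi x = x -> pi y = y -> F x y -> E2 x y.
  by move=> px py xy; rewrite E2E; right.
have /choice[Th ThE] g : exists S : aut E2, forall x, S x = theta g x.
  have [th' [[mth mth'] [thK thVK] thY thN]] := thetaP g.
  have th_fix x : pi (theta g x) = theta g x -> pi x = x.
    move=> h; have [//|px] := pselect (pi x = x).
    by rewrite thN in h.
  have thE2 x y : E2 x y <-> E2 (theta g x) (theta g y).
    rewrite !E2E; split=> [[->|[[px py] xy]]|[h|[[px py] xy]]]; first by left.
    - right; have [px' xT] := thY x px; have [py' yT] := thY y py; split=> //.
      exact: F_trans _ _ _ xT (F_trans _ _ _ (TF g _ _ xy) (F_sym _ _ yT)).
    - by left; apply: (can_inj thK).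
    - move/th_fix: px => px; move/th_fix: py => py; right; split=> //.
      have [_ xT] := thY x px; have [_ yT] := thY y py.
      apply: (extension_normV (T := T g) (normT' g)).
      exact: F_trans _ _ _ (F_sym _ _ xT) (F_trans _ _ _ xy yT).
  by exists (Aut thK thVK mth mth' thE2).
have ThY g x : pi x = x -> pi (Th g x) = Th g x /\ F (Th g x) (T g x).
  by rewrite ThE => px; have [th' [_ _ h _]] := thetaP g; apply: h.
have ThN g x : pi x <> x -> Th g x = x.
  by rewrite ThE => px; have [th' [_ _ _ h]] := thetaP g; apply: h.
(* Another representative of the coset would change [Th] only inside [E2]-classes. *)
pose f (a : quotient_group N) : out E2 := out_map E2 (Th (repr a)).
have reprK (a : quotient_group N) : quot_map N (repr a) = a.
  by rewrite /quot_map generic_quotient.reprK.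
have qM g h : quot_map N (g * h) = quot_map N g * quot_map N h.
  exact: (@gmulfM _ _ (@quot_map G N) g h).
have fM : {morph f : a b / a * b}.
  move=> a b; rewrite /f -gmulfM; apply/out_mapP => x.
  have [px|px] := pselect (pi x = x); last by rewrite autM !ThN//; apply: cber_refl.
  rewrite autM; have [pb bT] := ThY (repr b) x px.
  have [pab abT] := ThY (repr a) _ pb; have [pc cT] := ThY (repr (a * b)) x px.
  apply: E2I => //; apply: (F_trans _ _ _ cT _); apply: (F_trans _ _ _ _ (F_sym _ _ abT)).
  apply: (F_trans _ _ _ _ (TF _ _ _ (F_sym _ _ bT))).
  apply: (F_trans _ _ _ _ (EF _ _ (repT _ _ _))); apply: TN.
  by rewrite qM !reprK.
have f1 : f 1 = 1.
  by apply: (mulgI (f 1)); rewrite -fM !mulg1.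
pose hf := isUMagmaMorphism.Build (quotient_group N) (out E2) f (f1, fM).
pose phi : {ghom quotient_group N -> out E2} := HB.pack f hf.
have [psi [cbpsi psiE]] := liftH stdX phi.
have psiT a x : E2 (psi a x) (Th (repr a) x).
  by apply: (out_mapP _ _).1; exact: psiE.
(* The selected point of the orbit that is to contain [gamma g x]. *)
pose w g x := psi (quot_map N g) (pi x).
have wP g x : pi (w g x) = w g x /\ F (w g x) (T g x).
  have [pt tT] := ThY (repr (quot_map N g)) _ (pi_idem x).
  have [pw tw] := E2pi _ _ pt (cber_sym (psiT (quot_map N g) (pi x))).
  split=> //; apply: (F_trans _ _ _ (F_sym _ _ tw) _); apply: (F_trans _ _ _ tT _).
  apply: (F_trans _ _ _ (TN _ g _ (reprK _)) _); exact: TF _ _ _ (F_sym _ _ (piF x)).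
(* There is at most one such [z]: as [alpha] is class-bijective, an orbit meets each [E]-class at
   most once. *)
pose R g x z := E z (T g x) /\ pi z = w g x.
have Rfun g x z z' : R g x z -> R g x z' -> z = z'.
  move=> [zx pz] [zx' pz']; apply: (os_inj pi_sel cb); last by rewrite pz pz'.
  exact: cber_trans zx (cber_sym zx').
have mpi := os_bfun pi_sel.
have mw g : bfun (w g) by apply: bfun_comp => //; apply: aut_bfun.
have /choice[s sP] g : exists s : X -> X, bfun s /\ forall x, R g x (s x).
  have [s ms sR] : exists2 s, bfun s & forall x z, s x = z <-> R g x z.
    apply: (measurable_graph_cover (h := fun i x => alpha (e i) (w g x))).
    - by move=> i; apply: bfun_comp => //; apply: aut_bfun.
    - move=> i.
      have mi : bfun (fun x => alpha (e i) (w g x)).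
        by apply: bfun_comp => //; apply: aut_bfun.
      apply: bset_and; first by apply: (@brel_cber _ _ E) => //; apply: aut_bfun.
      by apply: meq => //; apply: bfun_comp.
    - move=> x; have [pw [n wn]] := wP g x; exists (alpha n (w g x)); split=> //.
      by rewrite (os_inv pi_sel).
    - move=> x z [_ pz]; have [pw _] := wP g x.
      have [n ->] : exists n, z = alpha n (w g x).
        by apply: (os_orbit pi_sel); rewrite pw.
      by have [i <-] := e_surj n; exists i.
    - exact: Rfun.
  by exists s; split=> // x; apply/sR.
have w1 x : w 1 x = pi x by rewrite /w (_ : quot_map N 1 = 1) ?act1.
have s1 x : s 1 x = x.
  apply: (Rfun 1 x); first by case: (sP 1).
  by split; [exact/cber_sym/T1|rewrite w1].
have sM g h x : s (g * h) x = s g (s h x).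
  apply: (Rfun (g * h) x); first by case: (sP (g * h)).
  have [E1 p1] := (sP g).2 (s h x); have [E3 p3] := (sP h).2 x; split.
    apply: cber_trans E1 _; apply: cber_trans ((aut_rel (T g) _ _).1 E3) _.
    exact: TM.
  by rewrite p1 /w p3 /w -actM -qM.
have sT g x : E (s g x) (T g x) by have [] := (sP g).2 x.
have [gamma gammaE] := ghom_of_action (fun g => (sP g).1) s1 sM sT.
exists gamma; split.
(* If [s g x] is [E]-related to [x], then [psi] moves [pi x] within its [E2]-class and hence fixes
   it, so [s g x] and [x] lie in the same orbit. *)
- move=> g x; rewrite gammaE => sx; apply: (os_inj pi_sel cb) => //.
  have [_ ->] := (sP g).2 x; have [pw wT] := wP g x.
  apply: cbpsi; apply: E2I => //.
  apply: (F_trans _ _ _ wT _); apply: (F_trans _ _ _ _ (piF x)); apply: EF.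
  exact: cber_trans (cber_sym (sT g x)) sx.
- move=> g /=; rewrite -TE; apply/out_mapP => x; rewrite gammaE; exact: sT.
- move=> n /=; apply: aut_ext => x; rewrite gammaE.
  apply: (Rfun (val n) x); first by case: (sP (val n)).
  split; first exact: alphaT.
  (* Elements of [N] have trivial coset, so [w (val n) x] is [pi x], the selected point of the orbit
     of [alpha n x]. *)
  rewrite (os_inv pi_sel) -w1 /w; congr (psi _ (pi x)); apply/quot_mapP.
  by rewrite invg1 mul1g; apply: subgroup_normal.
Qed.

(** Restricted to the finite group [N], the outer action has a class-bijective lift; the lifting
    property of the inclusion extends that lift to [G]. *)
Lemma outer_actions_lift_of_quotient : outer_actions_lift G.
Proof.
move=> d X stdX E phi; have [V sepV] := standard_borel_separating stdX.
have [m [e e_surj]] := subgroup_enum.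
have [T [repT TE]] := outer_rep_exists phi.
have repN : outer_rep (fun n : subgroup N => T (val n)).
  by move=> k l x; apply: repT.
have [alpha [cb alphaT]] := finite_outer_lift sepV repN e_surj.
have [||gamma [? ? _]] := subgroup_lifting_property stdX (alpha := alpha) (beta := phi).
- exact: cb.
- by move=> n /=; rewrite -TE; apply/out_mapP => x; apply: alphaT.
by exists gamma.
Qed.

End FiniteNormalSubgroup.

Theorem theorem5p6 (G : groupType) (N : normalSubgroup G)
    (countG : countable [set: G]%classic)
    (finN : finite_set N)
    (liftH : outer_actions_lift (quotient_group N)) :
  class_bijective_lifting_property (subgroup_incl N) /\
  outer_actions_lift G.
Proof.
split; first exact: subgroup_lifting_property.
exact: outer_actions_lift_of_quotient liftH.
Qed.
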